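(* Let $n\ge1$, let $\boldsymbol{B}^n$ be the Bellman function on $S$ defined in the context, let $B$ be the function on $\Omega$ defined in the context for $\alpha=2^{-n}$, and let $A^n(x;L)=L+B(T_Lx)$. Then $$\boldsymbol{B}^n(x,L)=A^n(x;L)\qquad\text{for all }(x,L)\in S.$$
   Context: $\mathcal{D}$: open dyadic cubes in $\mathbb{R}^n$; $\mathcal{D}(Q)$: dyadic subcubes of $Q$; $\langle\varphi\rangle_J=\frac1{|J|}\int_J\varphi$. $\varphi|_Q\in\mathrm{BMO}^d(Q)$ means $\|\varphi\|_{\mathrm{BMO}^d(Q)}:=\sup_{J\in\mathcal{D}(Q)}(\langle\varphi^2\rangle_J-\langle\varphi\rangle_J^2)^{1/2}<\infty$. $N\varphi(x)=\sup_{J\ni x,\,J\in\mathcal{D}}\langle\varphi\rangle_J$. $\Omega=\{(x_1,x_2)\in\mathbb{R}^2: x_1^2\le x_2\le x_1^2+1\}$ and $S=\{(x_1,x_2,L): x=(x_1,x_2)\in\Omega,\ x_1\le L\}$. For $(x,L)\in S$ and $Q\in\mathcal{D}$ let $E_{x,L,Q}$ be the set of $\varphi\in L^1_{loc}(\mathbb{R}^n)$ with $\varphi|_Q\in\mathrm{BMO}^d(Q)$, $\|\varphi\|_{\mathrm{BMO}^d(Q)}\le1$, $\langle\varphi\rangle_Q=x_1$, $\langle\varphi^2\rangle_Q=x_2$, $\sup_{R\supset Q,\,R\in\mathcal{D}}\langle\varphi\rangle_R=L$. The Bellman function is $\boldsymbol{B}^n(x,L)=\sup\{\langle N\varphi\rangle_Q:\varphi\in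 E_{x,L,Q}\}$; it does not depend on $Q$. For $a\in\mathbb{R}$, $T_a(x_1,x_2)=(x_1-a,\,x_2-2ax_1+a^2)$, a bijection of $\Omega$. The function $B$ on $\Omega$, for a given $\alpha\in(0,1/2]$: put $\tau=\frac1{\sqrt\alpha}-\sqrt\alpha$. - For $x_1\ge0$: $B(x)=x_1+\sqrt{x_2-x_1^2}$. - For $x_1\le0$, $x_2\le1$: $B(x)=x_1+\sqrt{x_2}$. - For $s\in[\sqrt\alpha,1]$ let $v(s)=\frac12(3s-\frac1s)-1$, $u(s)=v(s)-s$, and let $\ell_s$ be the closed segment joining $(u(s),u(s)^2)$ and $(v(s),v(s)^2+1)$. Let $\Omega_1$ be the union of these segments; each is contained in $\Omega$ and each $x\in\Omega_1$ lies on $\ell_s$ for a unique $s=s(x)$. Put $B(x)=\frac12(1+s^2)(x_1-u(s))$. - For $s\in[\alpha,\sqrt\alpha]$ let $v(s)=\frac12(\frac s\alpha+\frac\alpha s)-\tau-1$, $u(s)=v(s)-\frac\alpha s$, and let $\ell_s$ be the closed segment joining $(u(s),u(s)^2)$ and $(v(s),v(s)^2+1)$. Let $\Omega_2$ be the union of these segments; each is contained in $\Omega$ and each $x\in\Omega_2$ lies on $\ell_s$ for a unique $s=s(x)$. Put $B(x)=\frac\alpha2\big(1+\frac{s^2}{\alpha^2}\big)(x_1-u(s))$. - For $k\ge1$, let $\Omega_{2k+1}=T_{k\tau}\Omega_1$, $\Omega_{2k+2}=T_{k\tau}\Omega_2$, and for $x\in\Omega_{2k+1}\cup\Omega_{2k+2}$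 put $B(x)=\alpha^kB(T_{-k\tau}x)$. These sets cover $\Omega$ and the definitions agree where they overlap. *)

(* Defs.v *)
From HB Require Import structures.
From mathcomp Require Import all_boot all_order all_algebra.
From mathcomp Require Import all_classical all_reals all_analysis.

Set Implicit Arguments.
Unset Strict Implicit.
Unset Printing Implicit Defensive.

Import Order.TTheory GRing.Theory Num.Theory.
Import numFieldNormedType.Exports.

Local Open Scope classical_set_scope.
Local Open Scope ring_scope.
Local Open Scope ereal_scope.

(* R^n with its Borel sigma-algebra, i.e. the product of the Borel sigma-algebras
   of the factors. *)
Notation Rn R n := (n.-tuple (measurableTypeR R)).

Section lebesgue_measure_n.
Context {R : realType}.

Definition consRn n (p : measurableTypeR R * Rn R n) : Rn R n.+1 :=
  [the n.+1.-tuple (measurableTypeR R) of p.1 :: p.2].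

Lemma measurable_consRn n : measurable_fun setT (@consRn n).
Proof. exact: measurable_cons measurable_fst measurable_snd. Qed.

Section lebesgue_cons.
Context n (m : {sigma_finite_measure set (Rn R n) -> \bar R}).

Definition lebesgue_cons : set (Rn R n.+1) -> \bar R :=
  pushforward (@lebesgue_measure R \x m) (@consRn n).

Let lebesgue_cons0 : lebesgue_cons set0 = 0.
Proof. by rewrite /lebesgue_cons /pushforward preimage_set0 measure0. Qed.

Let lebesgue_cons_ge0 A : 0 <= lebesgue_cons A.
Proof. by rewrite /lebesgue_cons /pushforward measure_ge0. Qed.

Let lebesgue_cons_sigma_additive : semi_sigma_additive lebesgue_cons.
Proof.
have mc := @measurable_consRn n.
exact: (@measure_semi_sigma_additive _ _ _
  (measure_function_pushforward__canonical__measure_function_Measure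
     (@lebesgue_measure R \x m) mc)).
Qed.

HB.instance Definition _ := isMeasure.Build _ _ _ lebesgue_cons
  lebesgue_cons0 lebesgue_cons_ge0 lebesgue_cons_sigma_additive.

Let lebesgue_cons_sigma_finite : sigma_finite setT lebesgue_cons.
Proof.
have /sigma_finiteP[F [TF ndF Foo]] := sigma_finiteT (@lebesgue_measure R).
have /sigma_finiteP[G [TG ndG Goo]] := sigma_finiteT m.
pose uncons (t : Rn R n.+1) := (thead t, [tuple of behead t] : Rn R n).
have consK : cancel (@consRn n) uncons.
  by move=> [x t]; rewrite /uncons /consRn theadE; congr pair; exact/val_inj.
have munc : measurable_fun setT uncons.
  apply: measurable_fun_pair; first exact: measurable_tnth.
  exact: measurable_behead.
exists (fun k => uncons @^-1` (F k `*` G k)).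
  rewrite -preimage_bigcup; apply/esym/seteqP; split => // t _ /=.
  have [i _ Fi] : (\bigcup_k F k) (thead t) by rewrite -TF.
  have [j _ Gj] : (\bigcup_k G k) [tuple of behead t] by rewrite -TG.
  exists (maxn i j) => //; split => /=.
    by move: Fi; exact/subsetPset/ndF/leq_maxl.
  by move: Gj; exact/subsetPset/ndG/leq_maxr.
move=> k; have [mF Fk] := Foo k; have [mG Gk] := Goo k; split.
  by rewrite -[X in measurable X]setTI; apply: munc => //; exact: measurableX.
rewrite /lebesgue_cons /pushforward -comp_preimage.
rewrite (_ : uncons \o _ = idfun); last by apply/funext => p /=; rewrite consK.
by rewrite preimage_id product_measure1E// lte_mul_pinfty// ge0_fin_numE.
Qed.

HB.instance Definition _ := Measure_isSigmaFinite.Build _ _ _ lebesgue_cons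
  lebesgue_cons_sigma_finite.
End lebesgue_cons.

(* By induction, the image of lebesgue_measure \x lebesgue_measure_n n under
   (x, (x_1, .., x_n)) |-> (x, x_1, .., x_n). *)
Fixpoint lebesgue_measure_n n : {sigma_finite_measure set (Rn R n) -> \bar R} :=
  if n is n'.+1 then lebesgue_cons (lebesgue_measure_n n')
  else \d_([tuple] : Rn R 0).

Lemma lebesgue_measure_n_box n (A : 'I_n -> set R) :
  (forall i, measurable (A i : set (measurableTypeR R))) ->
  lebesgue_measure_n n [set t | forall i, A i (tnth t i)] =
  \prod_(i < n) lebesgue_measure (A i).
Proof.
elim: n A => [A _|n IH A mA].
  by rewrite big_ord0 /= diracE mem_set// => -[].
rewrite big_ord_recl -IH//.
rewrite -product_measure1E//; last first.
  rewrite (_ : [set _ | _] = \big[setI/setT]_(i < n)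
      ((fun t : Rn R n => tnth t i) @^-1` (A (lift ord0 i)))).
    apply: bigsetI_measurable => i _.
    by rewrite -[X in measurable X]setTI; exact: measurable_tnth.
  rewrite -bigcap_seq; apply/seteqP; split => t /= At i.
    by move=> _; exact: At.
  by apply: At; rewrite /= mem_index_enum.
rewrite /= /lebesgue_cons /pushforward; congr (_ _).
apply/seteqP; split => [[r t] /= At|[r t] /= [Ar At] i].
  by split; [have := At ord0|move=> i; have := At (lift ord0 i); rewrite tnthS].
by have [j ->|->] := unliftP ord0 i; rewrite ?tnthS//; exact: At.
Qed.
End lebesgue_measure_n.

Arguments lebesgue_measure_n {R} n.

Section bmo.
Context {R : realType} {n : nat}.
Implicit Types (J Q : set (Rn R n)) (phi : Rn R n -> R).

Definition avg J (f : Rn R n -> \bar R) : \bar R :=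
  (lebesgue_measure_n n J)^-1 * \int[lebesgue_measure_n n]_(t in J) f t.

(* Closed boxes replace compact sets: every compact set lies in a box. *)
Definition locally_integrable_n phi : Prop :=
  measurable_fun setT phi /\
  forall a b : Rn R n,
    \int[lebesgue_measure_n n]_(t in
        [set t | forall i, (tnth a i <= tnth t i <= tnth b i)%R])
      `|phi t|%:E < +oo.

Definition dyadic_cube (k : int) (m : 'I_n -> int) : set (Rn R n) :=
  [set t | forall i,
    (2 ^ k * (m i)%:~R < tnth t i < 2 ^ k * (m i + 1)%:~R)%R].

Definition dyadic : set (set (Rn R n)) :=
  [set Q | exists k m, Q = dyadic_cube k m].

(* The averages are extended reals, so that the average of phi ^ 2 over J, and
   with it the norm, is +oo when phi is not square integrable on J. *)
Definition bmo_norm Q phi : \bar R :=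
  ereal_sup [set sqrte (avg J (fun t => (phi t ^+ 2)%:E)
                        - avg J (EFin \o phi) ^+ 2)
            | J in dyadic `&` [set J | J `<=` Q]].

(* On the null set of points that lie in no open dyadic cube the supremum is
   over the empty set and equals -oo. *)
Definition dyadic_maximal phi (t : Rn R n) : \bar R :=
  ereal_sup [set avg J (EFin \o phi) | J in dyadic `&` [set J | J t]].

End bmo.

Section bellman.
Context {R : realType}.
Implicit Types (x : R * R) (L a : R).
Local Close Scope ereal_scope.

Definition Omega : set (R * R) :=
  [set x | x.1 ^+ 2 <= x.2 <= x.1 ^+ 2 + 1].

Definition S_domain : set ((R * R) * R) :=
  [set xL | Omega xL.1 /\ xL.1.1 <= xL.2].

Record bellman_class n x L (Q : set (Rn R n)) (phi : Rn R n -> R) : Prop := {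
  bellman_loc : locally_integrable_n phi ;
  bellman_bmo : (bmo_norm Q phi < +oo)%E ;
  bellman_norm : (bmo_norm Q phi <= 1)%E ;
  bellman_avg : avg Q (EFin \o phi) = x.1%:E ;
  bellman_avg2 : avg Q (fun t => (phi t ^+ 2)%:E) = x.2%:E ;
  bellman_sup : ereal_sup [set avg J (EFin \o phi)
                          | J in dyadic `&` [set J | Q `<=` J]] = L%:E }.

Definition bellman n (Q : set (Rn R n)) x L : \bar R :=
  ereal_sup [set avg Q (dyadic_maximal phi)
            | phi in [set phi | bellman_class x L Q phi]].

Definition Tshift a x : R * R := (x.1 - a, x.2 - 2 * a * x.1 + a ^+ 2).

(* ell_s once u = u(s) and v = v(s) are given. *)
Definition ell (u v : R) : set (R * R) :=
  [set x | exists2 t : R, 0 <= t <= 1 &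
    x = ((1 - t) * u + t * v, (1 - t) * u ^+ 2 + t * (v ^+ 2 + 1))].

Section B.
Variable alpha : R.

Definition tau : R := (Num.sqrt alpha)^-1 - Num.sqrt alpha.

Definition v1 (s : R) : R := 2^-1 * (3 * s - s^-1) - 1.
Definition u1 (s : R) : R := v1 s - s.

Definition v2 (s : R) : R := 2^-1 * (s / alpha + alpha / s) - tau - 1.
Definition u2 (s : R) : R := v2 s - alpha / s.

(* B_fan x y: x belongs to Omega_1 or Omega_2 and B(x) = y there. *)
Inductive B_fan : R * R -> R -> Prop :=
| B_Omega1 s x : Num.sqrt alpha <= s <= 1 -> ell (u1 s) (v1 s) x ->
    B_fan x (2^-1 * (1 + s ^+ 2) * (x.1 - u1 s))
| B_Omega2 s x : alpha <= s <= Num.sqrt alpha -> ell (u2 s) (v2 s) x ->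
    B_fan x (alpha / 2 * (1 + s ^+ 2 / alpha ^+ 2) * (x.1 - u2 s)).

(* The graph of B. In B_shift the case k = 0 is Omega_1 and Omega_2, and
   x \in T_{k tau} Omega_i is written T_{- k tau} x \in Omega_i. *)
Inductive B_graph : R * R -> R -> Prop :=
| B_right x : 0 <= x.1 -> B_graph x (x.1 + Num.sqrt (x.2 - x.1 ^+ 2))
| B_low x : x.1 <= 0 -> x.2 <= 1 -> B_graph x (x.1 + Num.sqrt x.2)
| B_shift (k : nat) x y : B_fan (Tshift (- (k%:R * tau)) x) y ->
    B_graph x (alpha ^+ k * y).

(* The clauses of B_graph cover Omega and agree on their overlaps there when
   alpha is in (0, 1/2], so on Omega the choice is of the only value. *)
Definition B x : R := xget 0 (B_graph x).

End B.

Definition bellman_candidate n x L : R := L + B (2 ^- n) (Tshift L x).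

End bellman.

(* Main.v *)
(* Let a = 2 ^ (- n / 2). On each segment of the foliation of Omega, B is the
   restriction of an affine function of (x_1, x_2), the plane of the segment.

   Upper bound. If x is the mean of 2 ^ n points x_i of Omega, then the mean of
   the B(x_i) is at most B(x): average the plane of the segment through x, which
   dominates B everywhere except far to the right. Since each x_i carries the
   weight a ^ 2, the variance of x lets at most one x_i lie that far, and then
   the plane of a segment further along the foliation can be used instead. By
   induction over the generations, this bounds the mean of the maximum of the
   averages over finitely many generations of dyadic subcubes, and monotone
   convergence gives the bound for N phi.

   Lower bound. Let F(x) be the supremum of these means over the finite dyadic
   trees of points of Omega with root x and leaves on the lower boundary. Grafting
   trees shows that F dominates its means over 2 ^ n points; being nonnegative,
   F is then concave along the segments contained in Omega. One step of weight
   a ^ 2 that leaves Omega in between gives the remaining jumps between the upper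
   boundary points of consecutive domains, and together these force F >= B. A tree
   is realized by a step function on Q, extended by L outside of Q. *)

Require Import Defs.
From mathcomp Require Import all_boot all_order all_algebra.
From mathcomp Require Import all_classical all_reals all_analysis.
From mathcomp Require Import measurable_realfun ring lra.
Set Implicit Arguments.
Unset Strict Implicit.
Unset Printing Implicit Defensive.
Import Order.TTheory GRing.Theory Num.Theory.
Import numFieldNormedType.Exports.
Local Open Scope classical_set_scope.
Local Open Scope ring_scope.

(** * Support planes *)

(** The parameter [X] is [s] on the domains of odd index and [s / alpha] on those of even index. It
    merges both families of segments into one: for fixed [k] it runs over [[a, a^-1]], and the last
    segment of generation [k] is the first one of generation [k.+1]. The obstacle is that Omega is
    not convex, so a plane touching B along a segment need not dominate B on all of Omega. For
    positive [k], [plane k X] is shown to dominate B where [gap k X z <= a^-1]. The number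
    [a^-1 = a + stp] is the horizontal length of the step of weight [a ^ 2] in the lower bound,
    which leads from a point of the lower boundary at distance [a] to one of the upper boundary at
    distance [stp] on the other side. Both bounds are proved for every value that [bval] admits at a
    point, so the agreement of the clauses of B comes out as a consequence, and only their covering
    of Omega has to be shown. On Q, [N phi - L] is nonnegative; it is integrated in place of
    [N phi], whose integrability is not known beforehand. *)

Ltac pos :=
  lazymatch goal with
  | |- is_true (0 <= _ + _) =>
      first [ done | by rewrite subr_ge0 | apply: addr_ge0; pos ]
  | |- is_true (0 <= _ * _) => apply: mulr_ge0; pos
  | |- is_true (0 <= _ ^-1) => rewrite invr_ge0; pos
  | |- is_true (0 <= _ ^+ 2) => apply: sqr_ge0
  | |- is_true (0 <= _ ^+ _) => apply: exprn_ge0; pos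
  | |- _ => try first [ done | apply: ltW; done ]
  end.

Section planes.
Variables (R : rcfType) (a : R).
Hypotheses (a_gt0 : 0 < a) (a_small : 2 * a ^+ 2 <= 1).
Implicit Types (X Y u : R) (z : R * R) (k j : nat).

(* With a = sqrt alpha, [window k X] is the segment ell_s of Omega_{2k+1} with
   s = X when X <= 1, and the one of Omega_{2k} with s = alpha X when X >= 1. The
   horizontal distance of z to its left end is [gap k X z], and [plane k X] is
   the affine function of (z.1, z.2) that equals B on it. *)
Definition vari z : R := z.2 - z.1 ^+ 2.
Definition uu X : R := 2^-1 * (X - X^-1) - 1.
Definition stp : R := a^-1 - a.
Definition gap k X z : R := z.1 + k%:R * stp - uu X.
Definition plane k X z : R :=
  a ^+ (2 * k) * (2^-1 * X) * (gap k X z ^+ 2 + vari z).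
Definition window k X z : Prop :=
  [/\ a <= X <= a^-1, 0 <= gap k X z, gap k X z <= X, gap k X z <= X^-1 &
      vari z = (X + X^-1) * gap k X z - gap k X z ^+ 2].

Let a_neq0 : a != 0. Proof. by rewrite gt_eqF. Qed.
Lemma a_lt1 : a < 1.
Proof using a_gt0 a_small.
by have h1 := a_gt0; have h2 := a_small; nra.
Qed.
Lemma ainvK : a * a^-1 = 1. Proof using a_gt0. by rewrite divff. Qed.
Lemma ainv_gt1 : 1 < a^-1.
Proof using a_gt0 a_small. by rewrite invf_gt1 ?a_lt1. Qed.
Lemma ainv_ge2a : 2 * a <= a^-1.
Proof using a_gt0 a_small. by rewrite -[leRHS]mul1r ler_pdivlMr// -mulrA -expr2. Qed.

(** * Comparison of the planes of one generation *)

Lemma gapB k X Y z : 0 < X -> 0 < Y ->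
  gap k X z = gap k Y z - 2^-1 * (X - Y) * (1 + (X * Y)^-1).
Proof using a_gt0.
move=> X0 Y0; rewrite /gap /uu.
by field; rewrite !gt_eqF.
Qed.

Lemma le_gap k X Y z : 0 < X -> X <= Y -> gap k Y z <= gap k X z.
Proof using a_gt0.
move=> X0 XY; have Y0 := lt_le_trans X0 XY.
rewrite (gapB k z Y0 X0) lerBlDr lerDl mulr_ge0//.
  by rewrite mulr_ge0 ?subr_ge0// invr_ge0.
by rewrite addr_ge0// invr_ge0 mulr_ge0// ltW.
Qed.

Lemma gap_le k X Y z : 0 < X -> 0 < Y -> gap k Y z <= gap k X z -> X <= Y.
Proof using a_gt0.
move=> X0 Y0; apply: contraTT; rewrite -!ltNge => YX.
rewrite (gapB k z X0 Y0) ltrBlDr ltrDl mulr_gt0//.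
  by rewrite mulr_gt0 ?subr_gt0// invr_gt0.
by rewrite addr_gt0// invr_gt0 mulr_gt0.
Qed.

(** Since [uu a^-1 - uu a = stp], consecutive generations share a segment. *)
Lemma gap_ainv k z : gap k.+1 a^-1 z = gap k a z.
Proof using a_gt0.
rewrite /gap /uu /stp -natr1.
by field.
Qed.

Lemma gapS k X z : gap k.+1 X z = gap k X z + stp.
Proof using. by rewrite /gap -natr1; ring. Qed.

Lemma plane_ainv k z : plane k.+1 a^-1 z = plane k a z.
Proof using a_gt0.
rewrite /plane gap_ainv mulnS exprD; congr (_ * _).
by field.
Qed.

(* The first summand vanishes on the line of the segment with parameter Y: along
   it, that segment has the smallest plane. *)
Lemma planeB k X Y z : 0 < X -> 0 < Y ->
  plane k X z - plane k Y z = a ^+ (2 * k) * 2^-1 *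
    ((X - Y) * (vari z + gap k Y z ^+ 2 - (Y + Y^-1) * gap k Y z) +
     (X - Y) ^+ 2 * ((X - Y^-1) ^+ 2 / (4 * X) + (Y^-1 - gap k Y z))).
Proof using a_gt0.
move=> X0 Y0; rewrite /plane (gapB k z X0 Y0).
move: (gap k Y z) (vari z) (a ^+ _) => D f al.
by field; rewrite !gt_eqF.
Qed.

(** The condition [gap k Y z <= Y^-1] makes the second summand of [planeB] nonnegative. It holds on
    the segment of [Y] and fails far to the right. *)
Lemma le_plane k X Y z : 0 < X -> 0 < Y -> gap k Y z <= Y^-1 ->
  0 <= (X - Y) * (vari z + gap k Y z ^+ 2 - (Y + Y^-1) * gap k Y z) ->
  plane k Y z <= plane k X z.
Proof using a_gt0.
move=> X0 Y0 gY h; rewrite -subr_ge0 planeB// mulr_ge0//.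
  by rewrite mulr_ge0 ?invr_ge0// exprn_ge0// ltW.
rewrite addr_ge0// mulr_ge0 ?sqr_ge0// addr_ge0 ?subr_ge0//.
by rewrite divr_ge0 ?sqr_ge0// mulr_ge0// ltW.
Qed.

Lemma window_gt0 k X z : window k X z -> 0 < X.
Proof using a_gt0. by case=> /andP[aX _] *; apply: lt_le_trans aX. Qed.

Lemma window_min k X Y z : window k X z -> 0 < Y -> plane k X z <= plane k Y z.
Proof using a_gt0.
move=> wX Y0; have X0 := window_gt0 wX; case: wX => _ _ _ gX vz.
by apply: le_plane => //; rewrite vz subrK subrr mulr0.
Qed.

(** The last hypothesis places [z] on or to the left of the segment of [a], so that both factors of
    the first summand of [planeB] are nonnegative. [plane_left] is the mirror image. *)
Lemma plane_right k X z : a <= X -> gap k a z <= a^-1 ->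
  (a + a^-1) * gap k a z - gap k a z ^+ 2 <= vari z ->
  plane k a z <= plane k X z.
Proof using a_gt0.
move=> aX ga h; apply: le_plane => //; first exact: lt_le_trans aX.
by rewrite mulr_ge0 ?subr_ge0// -lerBlDr.
Qed.

Lemma plane_left k X z : 0 < X -> X <= a^-1 -> gap k a^-1 z <= a ->
  vari z <= (a + a^-1) * gap k a^-1 z - gap k a^-1 z ^+ 2 ->
  plane k a^-1 z <= plane k X z.
Proof using a_gt0.
move=> X0 aX ga h; apply: le_plane; rewrite ?invr_gt0 ?invrK//.
by rewrite mulr_le0 ?subr_le0// -lerBrDr [_^-1 + _]addrC.
Qed.

(** On the upper boundary, [plane k.+1 X z - plane k X z] is a negative multiple of
    [(gap k X z - a) ^+ 2]. Hence the comparison of two generations has to change the parameter to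
    the [Y] that puts [z] at gap [a]. The summand with [1 - vari z] is kept for generation 0, where
    [plane 0 Y] need not dominate B when [Y > 1]. *)
Lemma plane_down k X Y z : a <= Y -> Y <= X -> X <= a^-1 -> gap k Y z = a ->
  plane k Y z + a ^+ (2 * k) * 2^-1 * ((1 - vari z) * (Y - a ^+ 2 * X)) <=
  plane k.+1 X z.
Proof using a_gt0.
move=> aY YX XA gY.
have Y0 : 0 < Y by exact: lt_le_trans aY.
have X0 : 0 < X by exact: lt_le_trans YX.
rewrite -subr_ge0 /plane gapS (gapB k z X0 Y0) gY mulnS exprD /stp.
move: (vari z) (a ^+ (2 * k)) (exprn_ge0 (2 * k) (ltW a_gt0)) => f al al0.
rewrite (_ : _ - _ = al * 2^-1 * a ^+ 2 * ((X - Y) * ((a^-1 - X) * (a^-1 - Y^-1)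
   + (X - Y) * (4^-1 * X) * (1 - (X * Y)^-1) ^+ 2))); last first.
  by field; rewrite !gt_eqF.
have YA : Y^-1 <= a^-1 by rewrite lef_pV2 ?posrE.
pos.
Qed.

Lemma slack_ge0 X Y f : a <= Y -> X <= a^-1 -> f <= 1 ->
  0 <= (1 - f) * (Y - a ^+ 2 * X).
Proof using a_gt0.
move=> aY XA f1; rewrite mulr_ge0 ?subr_ge0//; apply: le_trans aY.
by rewrite expr2 -mulrA ger_pMr// -ler_pdivlMl// mulr1.
Qed.

Lemma plane_down_le k X Y z : vari z <= 1 ->
  a <= Y -> Y <= X -> X <= a^-1 -> gap k Y z = a ->
  plane k Y z <= plane k.+1 X z.
Proof using a_gt0.
move=> f1 aY YX XA gY; apply: le_trans (plane_down aY YX XA gY).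
rewrite lerDl mulr_ge0 ?slack_ge0// mulr_ge0 ?invr_ge0// exprn_ge0// ltW//.
Qed.

Lemma uu_surj u : exists2 X, 0 < X & uu X = u.
Proof using a_gt0.
pose v := u + 1; pose s := Num.sqrt (v ^+ 2 + 1).
have s2 : s ^+ 2 = v ^+ 2 + 1 by rewrite sqr_sqrtr// addr_ge0// sqr_ge0.
have s0 : 0 <= s by rewrite sqrtr_ge0.
have X0 : 0 < v + s.
  have [v0|v0] := ltP 0 v; first by rewrite ltr_wpDr.
  have : `|v| < s by rewrite -ltr_sqr ?nnegrE// real_normK ?num_real// s2 ltrDl.
  by rewrite ler0_norm// -subr_gt0 opprK addrC.
exists (v + s) => //; rewrite /uu.
have -> : (v + s)^-1 = s - v.
  apply: (mulfI (lt0r_neq0 X0)); rewrite divff ?lt0r_neq0//.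
  have -> : (v + s) * (s - v) = s ^+ 2 - v ^+ 2 by ring.
  by rewrite s2; ring.
by rewrite /v; field.
Qed.

Lemma gap_surj k z g : exists2 Y, 0 < Y & gap k Y z = g.
Proof using a_gt0.
have [Y Y0 uY] := uu_surj (z.1 + k%:R * stp - g).
by exists Y => //; rewrite /gap uY; ring.
Qed.

(** Segments of one generation do not cross: a point on any of them lies on or to the left of the
    first one. The cases [1 <= X] and [X < 1] use the tighter of [gap <= X^-1] and [gap <= X]. *)
Lemma window_right k X z : window k X z ->
  gap k a^-1 z <= a /\
  (a + a^-1) * gap k a^-1 z - gap k a^-1 z ^+ 2 <= vari z.
Proof using a_gt0 a_small.
move=> w; have X0 := window_gt0 w; case: w => /andP[aX XA] g0 gX gXV ->.
have A0 : 0 < a^-1 by rewrite invr_gt0.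
have y0 : 0 < X^-1 by rewrite invr_gt0.
have ay : a <= X^-1 by rewrite -[a]invrK lef_pV2 ?posrE.
have Xy : X * X^-1 = 1 by rewrite divff ?gt_eqF.
have hump : X + X^-1 <= a^-1 + a.
  rewrite -subr_ge0 (_ : _ - _ = (a^-1 - X) * (1 - a * X^-1)).
    by rewrite mulr_ge0 ?subr_ge0// -ler_pdivlMl// mulr1 -[leRHS]invrK lef_pV2 ?posrE ?invr_gt0 ?invrK.
  by field; rewrite !gt_eqF.
rewrite (gapB k z A0 X0); move: (gap k X z) g0 gX gXV => D D0 DX DXV.
rewrite (_ : D - _ = D - 2^-1 * (a^-1 - X + X^-1 - a)); last first.
  by field; rewrite !gt_eqF.
split; first by lra.
rewrite -subr_ge0 (_ : _ - _ = (a^-1 - X) * (- (2 * D + X - X^-1) +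
   3 / 4 * (a^-1 + X) + 4^-1 * (a^-1 + X) * (a * X^-1) ^+ 2)); last first.
  by field; rewrite !gt_eqF.
rewrite mulr_ge0 ?subr_ge0//.
have [X1|X1] := leP 1 X.
  have y1 : X^-1 <= 1 by rewrite invf_le1.
  rewrite (_ : - _ + _ + _ = 2 * (X^-1 - D) + 2^-1 * (1 - X^-1 ^+ 2) ^+ 2 / X^-1 +
    4^-1 * (X^-1 - a) * (3 / (a * X^-1) - X^-1 * (2 * X^-1 + a))); last first.
    by field; rewrite !gt_eqF.
  have a1 := a_lt1.
  have hD : 0 <= 2 * (X^-1 - D) by lra.
  have h3 : X^-1 * (2 * X^-1 + a) <= 3 / (a * X^-1).
    rewrite (@le_trans _ _ 3)//; first by nra.
    rewrite ler_pdivlMr ?mulr_gt0// ler_piMr//.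
    by nra.
  by pos.
have y1 : 1 <= X^-1 by rewrite invf_ge1 ?ltW.
rewrite (_ : - _ + _ + _ = 2 * (X - D) + 2 * (X^-1 - X) +
    (a^-1 - X^-1) * 4^-1 * (3 - a * X^-1 - a ^+ 2 - a * X)); last first.
  by field; rewrite !gt_eqF.
have a1 := a_lt1.
have ay1 : a * X^-1 <= 1 by rewrite -ler_pdivlMl// mulr1 lef_pV2 ?posrE.
have aX1 : a * X <= 1 by rewrite mulr_ile1 ?(ltW a_gt0) ?(ltW X0) ?(ltW a1) ?(ltW X1).
have aa1 : a ^+ 2 <= 1 by rewrite exprn_ile1 ?(ltW a_gt0) ?(ltW a1).
have h : 0 <= 3 - a * X^-1 - a ^+ 2 - a * X by lra.
have X1' : X <= X^-1 by exact: le_trans (ltW X1) y1.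
have hD : 0 <= 2 * (X - D) by lra.
have yA : X^-1 <= a^-1 by rewrite lef_pV2 ?posrE.
by pos.
Qed.

(** The companion of [window_right] for the last segment, whose horizontal length is [a]; beyond it
    there is nothing to compare. *)
Lemma window_left k X z : window k X z -> gap k a z <= a ->
  vari z <= (a + a^-1) * gap k a z - gap k a z ^+ 2.
Proof using a_gt0 a_small.
move=> w; have X0 := window_gt0 w; case: w => /andP[aX XA] g0 gX gXV ->.
have y0 : 0 < X^-1 by rewrite invr_gt0.
rewrite (gapB k z a_gt0 X0); move: (gap k X z) g0 gX gXV => D D0 DX DXV h.
rewrite -subr_ge0 (_ : _ - _ = (X - a) * (- (2 * D + X - X^-1) +
   3 / 4 * (a + X) + 4^-1 * (a + X) * (a^-1 * X^-1) ^+ 2)); last first.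
  by field; rewrite !gt_eqF.
rewrite mulr_ge0 ?subr_ge0//.
have {}h : D + 2^-1 * (X - X^-1 + a^-1 - a) <= a.
  rewrite (_ : D + _ = D - 2^-1 * (a - X) * (1 + (a * X)^-1))//.
  by field; rewrite !gt_eqF.
have A2 := ainv_ge2a.
have : 0 <= 4^-1 * (a + X) * (a^-1 * X^-1) ^+ 2 by pos.
move: (_ * (_ ^+ 2)) => t t0; lra.
Qed.

(** The first plane of generation [j.+1] is the last one of generation [j], and [plane_right] puts
    it below all others of generation [j], the first one included. From there on the gap is at most
    0 and the side conditions hold trivially, so the induction continues. *)
Lemma chain_right j z : gap j a^-1 z <= a ->
  (a + a^-1) * gap j a^-1 z - gap j a^-1 z ^+ 2 <= vari z -> 0 <= vari z ->
  forall k X, (k < j)%N -> a <= X <= a^-1 -> plane j a^-1 z <= plane k X z.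
Proof using a_gt0 a_small.
elim: j => // j IH ga fa f0 k X.
have a_A : a <= a^-1 by have := a_lt1; have := ainv_gt1; lra.
rewrite plane_ainv.
move: ga fa; rewrite gap_ainv => ga fa; rewrite ltnS leq_eqVlt.
have ga' : gap j a z <= a^-1 by exact: le_trans ga a_A.
case/orP => [/eqP->|kj] /andP[aX XA]; first exact: plane_right.
have aA : a <= a^-1 <= a^-1 by rewrite a_A/=.
apply: le_trans (plane_right (proj1 (andP aA)) ga' fa) _.
have gj : gap j a^-1 z <= a - stp.
  rewrite -(lerD2r stp) -gapS gap_ainv; lra.
have g0 : gap j a^-1 z <= 0 by have := ainv_ge2a; rewrite /stp in gj; lra.
apply: IH => //; last by rewrite aX.
  by apply: le_trans g0 _; exact: ltW.
apply: le_trans f0; rewrite subr_le0 (@le_trans _ _ 0)// ?sqr_ge0//.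
by rewrite mulr_ge0_le0// addr_ge0 ?ltW// invr_gt0.
Qed.

Lemma window_dom_right j k X X' z : window j X' z -> 0 <= vari z ->
  (k <= j)%N -> a <= X <= a^-1 -> plane j X' z <= plane k X z.
Proof using a_gt0 a_small.
move=> w f0; rewrite leq_eqVlt => /orP[/eqP-> /andP[aX _]|kj aXA].
  by apply: window_min w _; exact: lt_le_trans aX.
have [? ?] := window_right w.
apply: le_trans (window_min w _) (chain_right _ _ _ kj aXA) => //.
by rewrite invr_gt0.
Qed.

(** The bound [b] is arbitrary in order to serve every branch of [bval]. Only the step from
    generation [j] to [j.+1] at gap at least [a] depends on the branch, and it is left as a
    hypothesis; later steps all follow from [plane_down_le]. *)
Lemma chain_left j z b : vari z <= 1 -> 0 <= gap j a z ->
  (gap j a z <= a -> vari z <= (a + a^-1) * gap j a z - gap j a z ^+ 2) ->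
  b <= plane j a z ->
  (forall X, a <= X <= a^-1 -> a <= gap j a z -> gap j.+1 X z <= a^-1 ->
    b <= plane j.+1 X z) ->
  forall k X, (j < k)%N -> a <= X <= a^-1 -> gap k X z <= a^-1 ->
    b <= plane k X z.
Proof using a_gt0 a_small.
move=> f1 g0 fa bj bS k X jk; rewrite -(subnKC jk).
elim: (k - j.+1)%N X => {jk k} [|k IH] X /andP[aX XA].
  rewrite addn0 => g1; have X0 : 0 < X by exact: lt_le_trans aX.
  have [ga|/ltW ga] := leP (gap j a z) a; last by apply: bS => //; rewrite aX.
  apply: le_trans bj _; rewrite -plane_ainv.
  by apply: plane_left => //; rewrite gap_ainv//; exact: fa.
have X0 : 0 < X by exact: lt_le_trans aX.
rewrite addnS; set m := (j.+1 + k)%N in IH *.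
(* The bound [a^-1] on the gap in generation [m.+1] is the bound [a] in generation [m], which gives
   [Y <= X]. Conversely [a <= Y], because [z] lies at least [stp >= a] to the right of the left end
   of the last segment of generation [m]. *)
move=> gX; have [Y Y0 gY] := gap_surj m z a.
have gXm : gap m X z <= a by move: gX; rewrite gapS /stp; lra.
have YX : Y <= X by apply: (gap_le (k := m) (z := z)) => //; rewrite gY.
have aY : a <= Y.
  apply: (gap_le (k := m) (z := z)) => //; rewrite gY.
  have -> : gap m a z = gap j a z + k.+1%:R * stp.
    by rewrite /m /gap addSnnS natrD; ring.
  have : 1 * stp <= k.+1%:R * stp.
    by rewrite ler_wpM2r ?ler1n// /stp; have := ainv_ge2a; have := a_gt0; lra.
  by have := ainv_ge2a; move: (k.+1%:R * stp) => t; rewrite /stp; lra.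
apply: le_trans (plane_down_le f1 aY YX XA gY).
have YA := le_trans YX XA.
apply: IH; first by rewrite aY.
by rewrite gY (le_trans (ltW a_lt1))// ltW// ainv_gt1.
Qed.

Lemma window_dom_left j k X X' z : window j X' z -> vari z <= 1 ->
  (j < k)%N -> a <= X <= a^-1 -> gap k X z <= a^-1 ->
  plane j X' z <= plane k X z.
Proof using a_gt0 a_small.
move=> w f1; have X'0 := window_gt0 w.
have aX' : a <= X' by case: w => /andP[].
have gX' : 0 <= gap j X' z by case: w.
have ga : 0 <= gap j a z by apply: le_trans gX' _; exact: le_gap.
apply: chain_left => //; first exact: window_left w.
  exact: window_min w _.
move=> {k}X /andP[aX XA] ag gX; have X0 : 0 < X by exact: lt_le_trans aX.
have [Y Y0 gY] := gap_surj j z a.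
have gXm : gap j X z <= a by move: gX; rewrite gapS /stp; lra.
have YX : Y <= X by apply: (gap_le (k := j) (z := z)) => //; rewrite gY.
have aY : a <= Y by apply: (gap_le (k := j) (z := z)) => //; rewrite gY.
apply: le_trans (plane_down_le f1 aY YX XA gY).
exact: window_min w _.
Qed.

(* By the arithmetic-geometric mean inequality this is a support plane of the
   first branch of B at z.1 = r and, for r = 0, of the second branch. *)
Definition lowplane r c z : R := z.1 + ((z.1 - r) ^+ 2 + vari z + c ^+ 2) / (2 * c).

(** The graph of B in the coordinates of [window]. Generation 0 consists of Omega_1 alone, hence
    [X <= 1] there; the two square root branches take the place of its other half. *)
Inductive bval z : R -> Prop :=
| bval_right : 0 <= z.1 -> bval z (z.1 + Num.sqrt (vari z))
| bval_low : z.1 <= 0 -> z.2 <= 1 -> bval z (z.1 + Num.sqrt z.2)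
| bval_window k X : window k X z -> (k = 0%N -> X <= 1) -> bval z (plane k X z).

(** * Domination of B by the planes *)

Lemma tau_ge : a <= stp.
Proof using a_gt0 a_small. by have := ainv_ge2a; rewrite /stp; lra. Qed.

Lemma window_out k X z : window k X z -> (k = 0%N -> X <= 1) -> 0 <= vari z ->
  z.1 <= 0 /\ 1 <= z.2.
Proof using a_gt0 a_small.
move=> w k0 f0; have X0 := window_gt0 w.
have vz : z.2 = vari z + z.1 ^+ 2 by rewrite subrK.
have a0 := a_gt0; have t0 := tau_ge; have a1 := a_lt1; have A1 := ainv_gt1; have A2 := ainv_ge2a.
case: k => [|k] in w k0 *.
  have {k0} X1 := k0 erefl; case: w => _ g0 gX _ vE.
  have z1 : z.1 = gap 0 X z + uu X by rewrite /gap; ring.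
  have u1 : uu X = - 1 - 2^-1 * (X^-1 - X) by rewrite /uu; ring.
  have XV : 1 <= X^-1 by rewrite invf_ge1.
  have hX : X <= X^-1 by lra.
  split; first by rewrite z1 u1; lra.
  rewrite vz vE z1 u1; move: (gap 0 X z) g0 gX => D g0 gX.
  rewrite -subr_ge0 (_ : _ - 1 = 2 * (X - D) * (1 - X) + (1 - X) * (1 + X - 2 * X ^+ 2) / X
     + (2^-1 * (X^-1 - X)) ^+ 2); last by field; rewrite gt_eqF.
  have h1 : 0 <= 1 + X - 2 * X ^+ 2.
    by rewrite (_ : _ - _ = (1 - X) * (1 + 2 * X)); [pos|ring].
  by pos.
have [ga fa] := window_right w; rewrite gap_ainv in ga fa.
have [aXA g0 gX gXV vE] := w.
have gkE : gap k a z = z.1 + k%:R * stp + 1 + 2^-1 * stp by rewrite /gap /uu /stp; ring.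
have kt : 0 <= k%:R * stp by rewrite mulr_ge0//; lra.
have gle : z.1 + 1 + 2^-1 * stp <= a by lra.
split; first by lra.
have [z1|z1] := leP z.1 (- 1).
  by rewrite vz; nra.
have k00 : k%:R * stp < a - 2^-1 * stp by lra.
(* A point with [z.1 > -1] is too far right for every generation after the first two; there the line
   of the segment [X = a] of Omega_1 decides. *)
have /eqP kz : k == 0%N.
  rewrite -leqn0 leqNgt; apply/negP => k1.
  have : 1 * stp <= k%:R * stp by rewrite ler_wpM2r ?ler1n//; lra.
  by lra.
rewrite kz mul0r addr0 in gkE; rewrite kz in fa.
rewrite gkE /stp in fa gle; rewrite vz; have aA := ainvK.
nra.
Qed.

Lemma uu_a : uu a = - 1 - 2^-1 * stp.
Proof using. by rewrite /uu /stp; ring. Qed.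

Lemma sqrX_le1 X : 0 < X -> X <= a^-1 -> a ^+ 2 * X <= 1.
Proof using a_gt0 a_small.
move=> X0 XA; have aX : a * X <= 1 by rewrite -ler_pdivlMl// mulr1.
apply: le_trans aX; rewrite expr2 -mulrA ger_pMl ?mulr_gt0//.
exact/ltW/a_lt1.
Qed.

Lemma plane01 z : plane 0 1 z = z.1 + 2^-1 * (1 + z.2).
Proof using. by rewrite /plane /gap /uu /vari invr1; field. Qed.

Lemma sqrt_half (f : R) : 0 <= f -> Num.sqrt f <= 2^-1 * (1 + f).
Proof using.
move=> f0; rewrite -[X in 1 + X](sqr_sqrtr f0) -subr_ge0.
by rewrite (_ : _ - _ = 2^-1 * (1 - Num.sqrt f) ^+ 2); [pos|field].
Qed.

Lemma sqrt_amgm (c f : R) : 0 < c -> 0 <= f -> Num.sqrt f <= (f + c ^+ 2) / (2 * c).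
Proof using.
move=> c0 f0; have g0 := sqrtr_ge0 f; have gE := sqr_sqrtr f0.
rewrite ler_pdivlMr ?mulr_gt0// -subr_ge0 -{1}gE.
by rewrite (_ : _ - _ = (Num.sqrt f - c) ^+ 2) ?sqr_ge0//; ring.
Qed.

(* [plane 0 X] touches the graph of [z.1 + sqrt (vari z)] at the second
   intersection point of its segment's line with the upper boundary. *)
Lemma plane0E X z : 0 < X -> plane 0 X z = z.1 + 1 +
  2^-1 * X * ((z.1 - (2^-1 * (X + X^-1) - 1)) ^+ 2 + vari z - 1).
Proof using. by move=> X0; rewrite /plane /gap /uu; field; rewrite gt_eqF. Qed.

(** Generation 0 needs no bound on the gap. On the first branch, squares are completed at the
    touching point shown by [plane0E]. On the second one, [plane 0 1] is above B by
    [sqrt x <= (1 + x) / 2], and the remaining planes are above [plane 0 1] by [le_plane]. *)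
Lemma plane0_dom X z b : a <= X -> X <= 1 -> 0 <= vari z <= 1 -> bval z b ->
  b <= plane 0 X z.
Proof using a_gt0 a_small.
move=> aX X1 /andP[f0 f1]; have X0 : 0 < X by exact: lt_le_trans aX.
have A1 := ainv_gt1.
case=> [z1|z1 z2|k X' w kX'].
- rewrite plane0E//; have g0 := sqrtr_ge0 (vari z); have gE := sqr_sqrtr f0.
  set g := Num.sqrt _ in g0 gE *; rewrite -gE.
  have g1 : g <= 1 by rewrite -ler_sqr ?nnegrE// expr1n gE.
  rewrite -subr_ge0 (_ : _ - _ =
    2^-1 * X * (z.1 - (2^-1 * (X + X^-1) - 1)) ^+ 2 +
    (1 - g) * (2^-1 * ((1 - g) + (1 - X) * (1 + g)))); last first.
    by field; rewrite gt_eqF.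
  by pos; apply: ltW; pos.
- have z20 : 0 <= z.2 by have := sqr_ge0 z.1; move: f0; rewrite /vari; lra.
  apply: (@le_trans _ _ (plane 0 1 z)).
    by rewrite plane01; have := sqrt_half z20; lra.
  have g1 : gap 0 1 z = z.1 + 1 by rewrite /gap /uu invr1; field.
  apply: le_plane => //; rewrite ?g1 ?invr1; first by lra.
  rewrite (_ : _ * _ = (1 - X) * (1 - z.2)); first by pos.
  by rewrite /vari; ring.
- by apply: window_dom_right => //; rewrite aX (le_trans X1)// ltW.
Qed.

Lemma lowplane_dom r c z b : 0 <= r -> 0 < c <= 1 -> 0 <= vari z <= 1 -> bval z b ->
  b <= lowplane r c z.
Proof using a_gt0 a_small.
move=> r0 /andP[c0 c1] f01 bz; have /andP[f0 f1] := f01.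
have vz : z.2 = vari z + z.1 ^+ 2 by rewrite subrK.
have z20 : 0 <= z.2 by rewrite vz addr_ge0// sqr_ge0.
have neg : z.1 <= 0 -> z.1 + (z.2 + c ^+ 2) / (2 * c) <= lowplane r c z.
  move=> z1; rewrite /lowplane lerD2l ler_pM2r ?invr_gt0 ?mulr_gt0// lerD2r vz.
  by rewrite [leRHS]addrC lerD2l; nra.
case: bz => [z1|z1 z2|k X w kX].
- rewrite /lowplane lerD2l (le_trans (sqrt_amgm c0 f0))//.
  by rewrite ler_pM2r ?invr_gt0 ?mulr_gt0// lerD2r lerDr sqr_ge0.
- apply: le_trans (neg z1); rewrite lerD2l; exact: sqrt_amgm.
- have [z1 z2] := window_out w kX f0; apply: le_trans (neg z1).
  have a1 := a_lt1.
  (* The plane of the segment [s = 1] mediates: it is below the goal because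
     [(z.2 - c) * (1 - c) >= 0]. *)
  apply: (@le_trans _ _ (plane 0 1 z)).
    by apply: plane0_dom => //; [exact: ltW|exact: bval_window].
  rewrite plane01 lerD2l ler_pdivlMr ?mulr_gt0//.
  by nra.
Qed.

Lemma chain_hyp_low z : z.1 <= 0 -> z.2 <= 1 -> 0 <= vari z ->
  0 <= gap 0 a z /\
  (gap 0 a z <= a -> vari z <= (a + a^-1) * gap 0 a z - gap 0 a z ^+ 2).
Proof using a_gt0 a_small.
move=> z1 z2 f0; have a0 := a_gt0; have t0 := tau_ge.
have A1 := ainv_gt1; have A2 := ainv_ge2a; have a1 := a_lt1.
have zm1 : - 1 <= z.1 by move: f0; rewrite /vari => ?; nra.
have gE : gap 0 a z = z.1 + 1 + 2^-1 * stp by rewrite /gap uu_a mul0r; ring.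
split; first by rewrite gE; lra.
rewrite gE => ga; have {z2} fz : vari z <= 1 - z.1 ^+ 2 by rewrite /vari; lra.
apply: le_trans fz _; have aA := ainvK.
have AA : 2 <= a^-1 ^+ 2.
  by have := a_small; rewrite exprVn -[2]invrK lef_pV2 ?posrE ?invr_gt0 ?exprn_gt0// => h; lra.
rewrite /stp in ga *; move: (z.1) zm1 z1 ga => p zm1 z1 ga.
rewrite -subr_ge0 (_ : _ - _ = - 2 * (1 - a) * (p + 1) +
  4^-1 * (a^-1 ^+ 2 + 2 * (a * a^-1) - 3 * a ^+ 2)); last by field.
rewrite aA; have := a_small; nra.
Qed.

Lemma plane1_low X z b : a <= X <= a^-1 -> 0 <= vari z <= 1 ->
  z.1 <= 0 -> z.2 <= 1 -> bval z b ->
  a <= gap 0 a z -> gap 1 X z <= a^-1 -> b <= plane 1 X z.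
Proof using a_gt0 a_small.
move=> /andP[aX XA] f01 z1 z2 bz ga gX; have /andP[f0 f1] := f01.
have X0 : 0 < X by exact: lt_le_trans aX.
have [Y Y0 gY] := gap_surj 0 z a.
have gXm : gap 0 X z <= a by move: gX; rewrite gapS /stp; lra.
have YX : Y <= X by apply: (gap_le (k := 0) (z := z)) => //; rewrite gY.
have aY : a <= Y by apply: (gap_le (k := 0) (z := z)) => //; rewrite gY.
have [Y1|Y1] := leP Y 1.
  apply: le_trans (plane_down_le f1 aY YX XA gY).
  exact: plane0_dom.
(* No segment of generation 0 has this [Y]: [b] is bounded by [plane 0 1], and the slack of
   [plane_down] helps to cover the difference to [plane 0 Y]. *)
apply: le_trans (plane_down aY YX XA gY).
have a1 := a_lt1; apply: le_trans (plane0_dom (ltW a1) (lexx _) f01 bz) _.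
rewrite plane01 /plane gY mul1r muln0 expr0 !mul1r.
have zE : z.1 = a + 2^-1 * (Y - Y^-1) - 1.
  by move: gY; rewrite /gap /uu mul0r addr0 => h; lra.
have -> : z.2 = vari z + z.1 ^+ 2 by rewrite subrK.
have ja : 0 <= 2^-1 * (1 + Y^-1) - a - 2^-1 * (Y - 1).
  by move: z1; rewrite zE; lra.
have aX1 : a ^+ 2 * X <= 1.
  exact: sqrX_le1.
rewrite zE; move: (vari z) f0 f1 => f f0 f1.
rewrite -subr_ge0 (_ : _ - _ = 2^-1 * ((1 - f) * (1 - a ^+ 2 * X)) +
  2^-1 * (Y - 1) * (((2^-1 * (1 + Y^-1) - a) ^+ 2 - (2^-1 * (Y - 1)) ^+ 2)
    + (2^-1 * (Y - 1)) ^+ 2 * (1 - Y^-1))); last first.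
  by field; rewrite !gt_eqF.
have Y1' : Y^-1 <= 1 by rewrite invf_le1// ltW.
have Ym : 0 <= Y - 1 by lra.
rewrite addr_ge0//; first by pos.
apply: mulr_ge0; first by pos.
by rewrite addr_ge0//; [nra|pos].
Qed.

Lemma plane1_right X z : a <= X <= a^-1 -> 0 <= vari z <= 1 -> 0 <= z.1 ->
  gap 1 X z <= a^-1 -> z.1 + Num.sqrt (vari z) <= plane 1 X z.
Proof using a_gt0 a_small.
move=> /andP[aX XA] /andP[f0 f1] z1 gX.
have X0 : 0 < X by exact: lt_le_trans aX.
have [Y Y0 gY] := gap_surj 0 z a.
have gXm : gap 0 X z <= a by move: gX; rewrite gapS /stp; lra.
have YX : Y <= X by apply: (gap_le (k := 0) (z := z)) => //; rewrite gY.
have a1 := a_lt1; have a0 := a_gt0; have t0 := tau_ge.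
have aY : a <= Y.
  apply: (gap_le (k := 0) (z := z)) => //; rewrite gY /gap uu_a mul0r; lra.
apply: le_trans (plane_down aY YX XA gY).
rewrite /plane gY mul1r muln0 expr0 !mul1r.
have zE : z.1 = a + 2^-1 * (Y - Y^-1) - 1.
  by move: gY; rewrite /gap /uu mul0r addr0 => h; lra.
have aX1 : a ^+ 2 * X <= 1.
  exact: sqrX_le1.
apply: le_trans (_ : z.1 + 2^-1 * (1 + vari z) <= _).
  by rewrite lerD2l sqrt_half.
rewrite zE; move: (vari z) f0 f1 => f f0 f1.
rewrite -subr_ge0 (_ : _ - _ = 2^-1 * ((1 - f) * (1 - a ^+ 2 * X)) +
  2^-1 * (a * Y - 1) ^+ 2 / Y); last by field; rewrite !gt_eqF.
by pos.
Qed.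

Lemma plane_dom k X z b : (0 < k)%N -> a <= X <= a^-1 -> 0 <= vari z <= 1 ->
  bval z b -> gap k X z <= a^-1 -> b <= plane k X z.
Proof using a_gt0 a_small.
move=> k0 aXA f01 bz gX; have /andP[f0 f1] := f01.
have a1 := a_lt1; have a0 := a_gt0; have t0 := tau_ge.
have b0 : b <= plane 0 a z by apply: plane0_dom => //; exact: ltW.
case: bz b0 => [z1|z1 z2|j X' w kX'] b0.
- apply: (@chain_left 0) gX => //; rewrite ?/gap ?uu_a ?mul0r; first by lra.
    by move=> h; exfalso; move: h; apply/negP; rewrite -ltNge; lra.
  by move=> Y aYA _ gY; exact: plane1_right.
- have [g0 ga] := chain_hyp_low z1 z2 f0.
  apply: (@chain_left 0) gX => //.
  by move=> Y aYA ? ?; apply: plane1_low => //; exact: bval_low.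
- have [kj|jk] := leqP k j; first exact: window_dom_right w _ _ _.
  exact: window_dom_left w _ _ _ _.
Qed.

(** * A child far to the right *)

Lemma far_core_near (D T X Y m f g : R) :
  a <= X -> X <= Y -> Y <= a^-1 -> T <= stp -> D <= 1 -> f <= 1 -> g <= 1 ->
  D = a^-1 - T + 2^-1 * (Y - X) * (1 + (X * Y)^-1) -> a ^+ 2 * Y <= m * X ->
  X * ((D + T - stp) ^+ 2 + f + (1 - m) * (1 - f)) +
  Y * ((a^-1 - T) ^+ 2 + g - a ^+ 2 * (a^-1 ^+ 2 + f)) <= X * (D ^+ 2 + g).
Proof using a_gt0 a_small.
move=> aX XY YA Tt D1 f1 g1 DE mX.
have a0 := a_gt0; have X0 : 0 < X by lra.
have Y0 : 0 < Y by lra.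
have a1 := a_lt1.
have hX : 2 <= X + X^-1.
  rewrite -subr_ge0 (_ : _ - _ = (X - 1) ^+ 2 / X); last by field; rewrite gt_eqF.
  by pos.
have hY : 2 <= Y + Y^-1.
  rewrite -subr_ge0 (_ : _ - _ = (Y - 1) ^+ 2 / Y); last by field; rewrite gt_eqF.
  by pos.
have hM : 0 <= 2^-1 * (X + X^-1 + Y + Y^-1) - D - a by lra.
have w0 : 0 <= stp - T by lra.
have e0 : 0 <= 1 - f by lra.
have g0 : 0 <= 1 - g by lra.
have XY0 : 0 <= Y - X by lra.
have m0 : 0 <= m * X - a ^+ 2 * Y by lra.
rewrite -subr_ge0 (_ : _ - _ = (Y - X) * (1 - g) +
   (Y - X) * (stp - T) * (2^-1 * (X + X^-1 + Y + Y^-1) - D - a) +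
   (1 - f) * (m * X - a ^+ 2 * Y)).
  by rewrite !addr_ge0// !mulr_ge0.
by rewrite DE /stp; field; rewrite !gt_eqF.
Qed.

Lemma far_core_ineq (v m : R) : 0 <= v <= 1 -> a <= m <= 1 ->
  2 * (m - a) + (1 - a ^+ 2) * v <= (2 * a^-1 + v) * (m - a ^+ 2).
Proof using a_gt0 a_small.
move=> /andP[v0 v1] /andP[am m1]; have a0 := a_gt0; have aA := ainvK.
have A1 := ltW ainv_gt1.
rewrite -subr_ge0 (_ : _ - _ = 2 * (m - a) * (a^-1 - 1) +
   (2 * (a * a^-1) - 2 * a - v * (1 - m)) ); last by field; rewrite gt_eqF.
have h : 0 <= 2 * (m - a) * (a^-1 - 1) by pos.
have h2 : v * (1 - m) <= 1 - a by nra.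
have a1 := a_lt1.
by rewrite aA; lra.
Qed.

Lemma far_core_mid (D v X Y m f g : R) :
  0 < X -> X <= Y -> 0 <= v <= 1 -> a <= m <= 1 -> D <= m -> f <= 1 -> g <= 1 ->
  a ^+ 2 * Y <= m * X -> 2 * a^-1 * v + v ^+ 2 <= 1 - f ->
  X * ((D + v) ^+ 2 + f + (1 - m) * (1 - f)) +
  Y * (a ^+ 2 + g - a ^+ 2 * ((a^-1 + v) ^+ 2 + f)) <= X * (D ^+ 2 + g).
Proof using a_gt0 a_small.
move=> X0 XY v01 m01 Dm f1 g1 mX ev; have h := far_core_ineq v01 m01.
have /andP[v0 v1] := v01; have a0 := a_gt0.
have g0 : 0 <= 1 - g by lra.
have XY0 : 0 <= Y - X by lra.
have m0 : 0 <= m * X - a ^+ 2 * Y by lra.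
have ev0 : 0 <= 1 - f - (2 * a^-1 * v + v ^+ 2) by lra.
have h0 : 0 <= (2 * a^-1 + v) * (m - a ^+ 2) - 2 * (D - a) - (1 - a ^+ 2) * v by lra.
rewrite -subr_ge0 (_ : _ - _ = (Y - X) * (1 - g) +
   (1 - f - (2 * a^-1 * v + v ^+ 2)) * (m * X - a ^+ 2 * Y) +
   v * X * ((2 * a^-1 + v) * (m - a ^+ 2) - 2 * (D - a) - (1 - a ^+ 2) * v)).
  by rewrite !addr_ge0// !mulr_ge0// ltW.
by field; rewrite !gt_eqF.
Qed.

Lemma far_core_low (D v m f : R) :
  0 <= v <= 1 -> a <= m <= 1 -> D <= a -> 0 <= D - a + v -> f <= 1 ->
  2 * a^-1 * v + v ^+ 2 <= 1 - f ->
  (D + v) ^+ 2 + f + (1 - m) * (1 - f) <= a ^+ 2 * ((D + stp + v) ^+ 2 + f).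
Proof using a_gt0 a_small.
move=> v01 m01 Da g0 f1 ev; have h := far_core_ineq v01 m01.
have /andP[v0 v1] := v01; have a0 := a_gt0; have /andP[am m1] := m01.
have a1 := a_lt1.
have aa : a ^+ 2 <= a by rewrite expr2 ger_pMl// ltW.
have aa1 : 0 <= 1 - a ^+ 2 by lra.
have ma : 0 <= m - a ^+ 2 by lra.
have ev0 : 0 <= 1 - f - (2 * a^-1 * v + v ^+ 2) by lra.
have gv : (D - a + v) ^+ 2 <= v ^+ 2.
  by rewrite ler_sqr ?nnegrE//; lra.
have gv0 : 0 <= v ^+ 2 - (D - a + v) ^+ 2 by lra.
have h0 : 0 <= (2 * a^-1 + v) * (m - a ^+ 2) - (1 - a ^+ 2) * v by lra.
rewrite -subr_ge0 (_ : _ - _ =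
   (1 - f - (2 * a^-1 * v + v ^+ 2)) * (m - a ^+ 2) +
   (v * ((2 * a^-1 + v) * (m - a ^+ 2) - (1 - a ^+ 2) * v) +
   (1 - a ^+ 2) * (v ^+ 2 - (D - a + v) ^+ 2))).
  by rewrite !addr_ge0// !mulr_ge0.
by rewrite /stp; field; rewrite !gt_eqF.
Qed.

(** For [X > 1], [plane 0 X] belongs to no segment and may lie below B. The correction, zero on the
    upper boundary, turns it into [z.1 + (1 + vari z) / 2] plus a square. *)
Lemma far_bound k X z b : a <= X <= a^-1 -> 0 <= vari z <= 1 -> bval z b ->
  gap k X z <= a^-1 ->
  b <= plane k X z + a ^+ (2 * k) * (2^-1 * X) *
       ((1 - Num.min 1 X^-1) * (1 - vari z)).
Proof using a_gt0 a_small.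
move=> aXA f01 bz gX; have /andP[aX XA] := aXA; have /andP[f0 f1] := f01.
have X0 : 0 < X by exact: lt_le_trans aX.
have m0 : 0 <= 1 - Num.min 1 X^-1 by rewrite subr_ge0 ge_min lexx.
have f0' : 0 <= 1 - vari z by lra.
have s0 : 0 <= a ^+ (2 * k) * (2^-1 * X) * ((1 - Num.min 1 X^-1) * (1 - vari z)).
  by pos.
have [k0|k0] := posnP k; last first.
  by apply: le_trans (plane_dom k0 aXA f01 bz gX) _; rewrite lerDl.
rewrite {}k0 in gX s0 *; have [X1|X1] := leP X 1.
  by apply: le_trans (plane0_dom aX X1 f01 bz) _; rewrite lerDl.
have -> : Num.min 1 X^-1 = X^-1 by rewrite min_r// invf_le1// ltW.
have wX : 0 <= 2^-1 * (X + X^-1) - 1.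
  rewrite (_ : _ - _ = (X - 1) ^+ 2 / (2 * X)); last by field; rewrite gt_eqF.
  by pos.
rewrite plane0E// muln0 expr0 mul1r.
rewrite [leRHS](_ : _ = z.1 + 2^-1 * (1 + vari z) +
  2^-1 * X * (z.1 - (2^-1 * (X + X^-1) - 1)) ^+ 2); last first.
  by field; rewrite gt_eqF.
have X0' := ltW X0.
have [z1|z1] := leP 0 z.1.
  case: bz z1 => [_ _|z1 z2 z1'|j X' w kX' z1].
  - apply: (@le_trans _ _ (z.1 + 2^-1 * (1 + vari z))).
      by rewrite lerD2l sqrt_half.
    by rewrite lerDl; pos.
  - have z10 : z.1 = 0 by apply/eqP; rewrite eq_le z1.
    have vE : vari z = z.2 by rewrite /vari z10 expr0n/= subr0.
    apply: (@le_trans _ _ (z.1 + 2^-1 * (1 + vari z))).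
      by rewrite lerD2l -vE sqrt_half.
    by rewrite lerDl; pos.
  - have [z1' _] := window_out w kX' f0.
    have z10 : z.1 = 0 by apply/eqP; rewrite eq_le z1'.
    apply: (@le_trans _ _ (plane 0 1 z)).
      by apply: plane0_dom => //; [exact/ltW/a_lt1|exact: bval_window].
    rewrite plane01; apply: (@le_trans _ _ (z.1 + 2^-1 * (1 + vari z))).
      by rewrite /vari z10 expr0n/= subr0.
    by rewrite lerDl; pos.
apply: (@le_trans _ _ (plane 0 1 z)).
  by apply: plane0_dom => //; exact/ltW/a_lt1.
rewrite plane01 -[in leLHS](subrK (z.1 ^+ 2) z.2) -/(vari z).
have h : 1 * z.1 ^+ 2 <= X * (z.1 - (2^-1 * (X + X^-1) - 1)) ^+ 2.
  rewrite ler_pM ?sqr_ge0//; first exact: ltW.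
  by move: (2^-1 * _ - 1) wX => w wX; nra.
by rewrite -[2^-1 * X * _]mulrA; move: (X * _) h => t h; lra.
Qed.

Lemma eqW (x y : R) : x = y -> x <= y. Proof using. by move=> ->. Qed.

Lemma gap_shift k X x z : gap k X z = gap k X x + (z.1 - x.1).
Proof using. by rewrite /gap; ring. Qed.

(* Some [x_i] lies too far to the right for the plane of [x] to dominate there:
   the plane of a more advanced segment then pays for it. *)
Lemma far_step k X x z bz : window k.+1 X x -> vari x <= 1 ->
  0 <= vari z <= 1 -> bval z bz -> a^-1 <= gap k.+1 X z ->
  (forall c, a ^+ 2 * ((z.1 - c) ^+ 2 + vari z) <= (x.1 - c) ^+ 2 + vari x) ->
  exists Y, [/\ a <= Y <= a^-1,
    plane k.+1 Y x + a ^+ 2 * (bz - plane k.+1 Y z) <= plane k.+1 X x &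
    gap k.+1 Y z <= a^-1 \/ gap k.+1 Y x <= a /\ stp < z.1 - x.1].
Proof using a_gt0 a_small.
move=> w g1 f01 bzz far var_le; have X0 := window_gt0 w.
have [/andP[aX XA] D0 DX DXV _] := w; have [gA _] := window_right w.
have /andP[f0 f1] := f01; have a0 := a_gt0; have a1 := a_lt1; have t0 := tau_ge.
have A1 := ainv_gt1; have A2 := ainv_ge2a; have aA := ainvK.
set m := Num.min 1 X^-1.
have aXV : a <= X^-1 by rewrite -[a]invrK lef_pV2 ?posrE ?invr_gt0.
have am : a <= m by rewrite le_min (ltW a1).
have m1 : m <= 1 by rewrite ge_min lexx.
have am1 : a <= m <= 1 by rewrite am.
have Dm : gap k.+1 X x <= m.
  rewrite le_min DXV andbT; have [X1|/ltW X1] := leP X 1; first lra.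
  by apply: le_trans DXV _; rewrite invf_le1.
have mX : a <= m * X.
  rewrite /m /Num.min; case: ifP => _; first by rewrite mul1r.
  by rewrite mulVf ?gt_eqF// ltW.
have aY Y : 0 < Y -> Y <= a^-1 -> a ^+ 2 * Y <= m * X.
  move=> Y0 YA; apply: le_trans mX; rewrite expr2 -mulrA -[leRHS]mulr1.
  by rewrite ler_pM2l// -ler_pdivlMl// mulr1.
set T := z.1 - x.1.
have vT c : a ^+ 2 * ((T + c) ^+ 2 + vari z) <= c ^+ 2 + vari x.
  by have := var_le (x.1 - c); rewrite /T !opprB !addrA !(addrC _ c) addrK addrA.
have vT1 c : a ^+ 2 * (T + c) ^+ 2 <= c ^+ 2 + 1.
  have := vT c; rewrite mulrDr => h; have : 0 <= a ^+ 2 * vari z by pos.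
  by lra.
(* The variance bounds the displacement [T] of a child of weight [a ^ 2]. This keeps the gap of [z]
   in the previous generation [k] at most [a^-1], so that [far_bound] applies there. *)
have Ta : T + a <= 2 * a^-1 - 1.
  rewrite leNgt; apply/negP => Ta; have := vT1 a; apply/negP; rewrite -ltNge.
  apply: (@lt_le_trans _ _ (a ^+ 2 * (2 * a^-1 - 1) ^+ 2)).
    rewrite (_ : _ * _ = (2 * (a * a^-1) - a) ^+ 2); last by ring.
    by rewrite aA; have := a_small; nra.
  rewrite ler_pM2l ?exprn_gt0// ler_sqr ?nnegrE; last 2 first.
  - by lra.
  - by lra.
  exact: ltW.
have gz : gap k X z = gap k.+1 X x + T - stp.
  by rewrite (gap_shift k X x) -/T gapS; ring.
have gz1 : gap k X z <= a^-1 by rewrite gz /stp; lra.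
have aXA : a <= X <= a^-1 by rewrite aX.
have := far_bound aXA f01 bzz gz1; rewrite -/m.
set S := a ^+ (2 * k) * (2^-1 * X) * _ => bzS.
set c0 := a ^+ (2 * k.+1) * 2^-1.
have c00 : 0 <= c0 by rewrite /c0; pos.
have bz' : a ^+ 2 * bz <= c0 * (X * ((gap k.+1 X x + T - stp) ^+ 2 + vari z +
    (1 - m) * (1 - vari z))).
  apply: (@le_trans _ _ (a ^+ 2 * (plane k X z + S))).
    by rewrite ler_pM2l// exprn_gt0.
  rewrite /plane /S gz /c0 mulnS exprD; apply/eqW.
  by move: (gap _ _ _) (a ^+ (2 * k)) => D al; ring.
have reduce Y g : gap k.+1 Y x = g ->
    X * ((gap k.+1 X x + T - stp) ^+ 2 + vari z + (1 - m) * (1 - vari z)) +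
    Y * (g ^+ 2 + vari x - a ^+ 2 * ((g + T) ^+ 2 + vari z)) <=
    X * (gap k.+1 X x ^+ 2 + vari x) ->
    plane k.+1 Y x + a ^+ 2 * (bz - plane k.+1 Y z) <= plane k.+1 X x.
  move=> gE h; have := ler_wpM2l c00 h; rewrite mulrDr => {}h.
  rewrite /plane (gap_shift _ _ x z) gE -/T.
  rewrite [leRHS](_ : _ = c0 * (X * (gap k.+1 X x ^+ 2 + vari x))); last first.
    by rewrite /c0; ring.
  apply: le_trans h.
  rewrite [leLHS](_ : _ = a ^+ 2 * bz +
     c0 * (Y * (g ^+ 2 + vari x - a ^+ 2 * ((g + T) ^+ 2 + vari z)))); last first.
    by rewrite /c0; ring.
  by rewrite lerD2r.
(* The choice of [Y]. If [T <= stp], it puts [z] at gap exactly [a^-1]. Otherwise it puts [x] at gap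
   [a], unless the gap of [x] is already at most [a], where [X] itself serves. *)
have [Tt|Tt] := leP T stp.
  have [Y Y0 gY] := gap_surj k.+1 z a^-1.
  have XY : X <= Y by apply: (gap_le (k := k.+1) (z := z)) => //; rewrite gY.
  have gYx : gap k.+1 Y x = a^-1 - T by move: gY; rewrite (gap_shift _ _ x z) -/T; lra.
  have YA : Y <= a^-1.
    apply: (gap_le (k := k.+1) (z := x)); rewrite ?invr_gt0//.
    by apply: le_trans gA _; rewrite gYx; move: Tt; rewrite /stp; lra.
  exists Y; split; first by rewrite (le_trans aX).
    apply: (reduce _ _ gYx); rewrite (_ : a^-1 - T + T = a^-1); last by ring.
    apply: far_core_near => //; [by lra| |exact: aY].
    by rewrite -gYx (gapB k.+1 x X0 Y0); field; rewrite !gt_eqF.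
  by left; rewrite gY.
have ev : 2 * a^-1 * (T - stp) + (T - stp) ^+ 2 <= 1 - vari z.
  have := vT a; rewrite (_ : T + a = a^-1 + (T - stp)); last by rewrite /stp; ring.
  move: (T - stp) => v hv; rewrite -(ler_pM2l (exprn_gt0 2 a_gt0)).
  have -> : a ^+ 2 * (2 * a^-1 * v + v ^+ 2) = a ^+ 2 * (a^-1 + v) ^+ 2 - 1.
    by field; rewrite gt_eqF.
  by lra.
have v01 : 0 <= T - stp <= 1.
  have v0 : 0 <= T - stp by rewrite subr_ge0 ltW.
  rewrite v0 -(@expr_le1 _ 2)//; apply: le_trans (_ : 1 - vari z <= _); last by lra.
  apply: le_trans ev; rewrite lerDr; pos.
have [Da|/ltW Da] := leP (gap k.+1 X x) a.
  exists X; split=> //; last by right.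
  apply: (reduce _ _ erefl).
  have : (gap k.+1 X x + (T - stp)) ^+ 2 + vari z + (1 - m) * (1 - vari z) <=
     a ^+ 2 * ((gap k.+1 X x + stp + (T - stp)) ^+ 2 + vari z).
    apply: far_core_low => //.
    move: far; rewrite (gap_shift _ _ x z) -/T -subr_ge0; congr (0 <= _).
    by rewrite /stp; ring.
  rewrite (_ : _ + stp + _ = gap k.+1 X x + T); last by ring.
  by move=> h; rewrite -mulrDr ler_pM2l//; lra.
have [Y Y0 gY] := gap_surj k.+1 x a.
have XY : X <= Y by apply: (gap_le (k := k.+1) (z := x)) => //; rewrite gY.
have YA : Y <= a^-1.
  by apply: (gap_le (k := k.+1) (z := x)); rewrite ?invr_gt0// gY.
exists Y; split; first by rewrite (le_trans aX).
  apply: (reduce _ _ gY).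
  rewrite (_ : a + T = a^-1 + (T - stp)); last by rewrite /stp; ring.
  rewrite (_ : _ + T - stp = gap k.+1 X x + (T - stp)); last by ring.
  apply: far_core_mid => //; exact: aY.
by right; rewrite gY.
Qed.

(** * The mean inequality *)

Section mean.
Variables (I : finType) (x : R * R) (xi : I -> R * R).
Hypotheses (aN : a ^+ 2 * #|I|%:R = 1).
Hypothesis x1E : x.1 = a ^+ 2 * \sum_i (xi i).1.
Hypothesis x2E : x.2 = a ^+ 2 * \sum_i (xi i).2.

Lemma mean_affine p q r :
  a ^+ 2 * \sum_i (p + q * (xi i).1 + r * (xi i).2) = p + q * x.1 + r * x.2.
Proof using aN x1E x2E.
rewrite !big_split/= -!mulr_sumr x1E x2E sumr_const -mulr_natr.
transitivity (p * (a ^+ 2 * #|I|%:R) + q * (a ^+ 2 * \sum_i (xi i).1) +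
   r * (a ^+ 2 * \sum_i (xi i).2)); last by rewrite aN mulr1.
ring.
Qed.

Lemma mean_plane k X : a ^+ 2 * \sum_i plane k X (xi i) = plane k X x.
Proof using aN x1E x2E.
set c := a ^+ (2 * k) * (2^-1 * X); pose v := uu X - k%:R * stp.
have E z : plane k X z = c * v ^+ 2 + (- 2 * v * c) * z.1 + c * z.2.
  by rewrite /plane -/c /gap /vari /v; ring.
by under eq_bigr do rewrite E; rewrite mean_affine E.
Qed.

Lemma mean_lowplane r c : c != 0 ->
  a ^+ 2 * \sum_i lowplane r c (xi i) = lowplane r c x.
Proof using aN x1E x2E.
move=> c0; have E z : lowplane r c z =
    (r ^+ 2 + c ^+ 2) / (2 * c) + (1 - r / c) * z.1 + (2 * c)^-1 * z.2.
  by rewrite /lowplane /vari; field.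
by under eq_bigr do rewrite E; rewrite mean_affine E.
Qed.

(** The function [(z.1 - c) ^+ 2 + vari z] is affine in [z], so its mean is exact; the terms outside
    [J] are nonnegative and dropped. *)
Lemma mean_var (J : {set I}) c : (forall i, 0 <= vari (xi i)) ->
  a ^+ 2 * \sum_(i in J) ((xi i).1 - c) ^+ 2 + a ^+ 2 * \sum_(i in J) vari (xi i)
  <= (x.1 - c) ^+ 2 + vari x.
Proof using aN x1E x2E.
move=> f0; have E z : (z.1 - c) ^+ 2 + vari z = c ^+ 2 + (- 2 * c) * z.1 + 1 * z.2.
  by rewrite /vari; ring.
rewrite E -mean_affine -mulrDr -big_split/=; under eq_bigr do rewrite E.
rewrite ler_wpM2l ?sqr_ge0// [leRHS](bigID (mem J))/= lerDl sumr_ge0// => i _.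
by rewrite -E addr_ge0 ?sqr_ge0.
Qed.

Lemma main_ineq b (bi : I -> R) : 0 <= vari x <= 1 ->
  (forall i, 0 <= vari (xi i) <= 1) -> bval x b -> (forall i, bval (xi i) (bi i)) ->
  a ^+ 2 * \sum_i bi i <= b.
Proof using All.
move=> g01 f01 bx bxi; have /andP[g0 g1] := g01.
have f0 i : 0 <= vari (xi i) by have /andP[] := f01 i.
have low r c : 0 <= r -> 0 < c <= 1 -> a ^+ 2 * \sum_i bi i <= lowplane r c x.
  move=> r0 c01; have /andP[c0 c1] := c01.
  rewrite -(mean_lowplane _ (lt0r_neq0 c0)) ler_wpM2l ?sqr_ge0// ler_sum// => i _.
  exact: lowplane_dom.
(* The choice [c = sqrt g] makes [lowplane] equal to the root branch at [x]. For [g = 0] this [c] is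
   not allowed, and the bound is obtained as [c] tends to 0. *)
have low_root r (g : R) : 0 <= r -> 0 <= g <= 1 -> (x.1 - r) ^+ 2 + vari x = g ->
    a ^+ 2 * \sum_i bi i <= x.1 + Num.sqrt g.
  move=> r0 /andP[g0' g1'] gE; move: (low r); rewrite /lowplane gE => {}low.
  have s0 := sqrtr_ge0 g; have sE := sqr_sqrtr g0'.
  have [s00|s00] := eqVneq (Num.sqrt g) 0.
    have {}g00 : g = 0 by rewrite -sE s00 expr0n.
    rewrite s00 addr0; apply/ler_addgt0Pr => e e0.
    have c01 : 0 < Num.min 1 e <= 1 by rewrite lt_min ltr01 e0 ge_min lexx.
    have := low _ r0 c01; set c := Num.min 1 e in c01 *; rewrite g00 add0r => h.
    apply: le_trans h _; rewrite lerD2l.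
    have /andP[c0 _] := c01; have ce : c <= e by rewrite ge_min lexx orbT.
    rewrite (_ : _ / _ = c / 2); last by field; rewrite gt_eqF.
    by lra.
  have sp : 0 < Num.sqrt g by rewrite lt_def s00.
  have c01 : 0 < Num.sqrt g <= 1.
    by rewrite sp -ler_sqr ?nnegrE// expr1n sE.
  apply: le_trans (low _ r0 c01) _; rewrite lerD2l -{1}sE.
  by apply/eqW; field.
case: bx => [x1|x1 x2|[|k] X w kX].
- by apply: (low_root x.1) => //; rewrite subrr expr0n add0r.
- apply: (low_root 0) => //; last by rewrite subr0 /vari addrC subrK.
  rewrite x2 andbT; have := sqr_ge0 x.1; move: g0; rewrite /vari; lra.
- have [/andP[aX _] _ _ _ _] := w; rewrite -mean_plane.
  rewrite ler_wpM2l ?sqr_ge0// ler_sum// => i _.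
  by apply: plane0_dom => //; exact: kX.
have [aXA _ _ _ _] := w; have X0 := window_gt0 w.
have [/forallP near|] := boolP [forall i, gap k.+1 X (xi i) <= a^-1].
  rewrite -mean_plane ler_wpM2l ?sqr_ge0// ler_sum// => i _; exact: plane_dom.
rewrite negb_forall => /existsP[i1]; rewrite -ltNge => far1.
(* The rightmost child is the one to pay for: every other gap is then at most its gap. *)
pose i0 := [arg max_(i > i1) (xi i).1]%O.
have i0_max i : (xi i).1 <= (xi i0).1 by rewrite /i0; case: arg_maxP => // j _ h; exact: h.
have far : a^-1 <= gap k.+1 X (xi i0).
  by apply: le_trans (ltW far1) _; rewrite /gap !lerD2r.
have vle c : a ^+ 2 * (((xi i0).1 - c) ^+ 2 + vari (xi i0)) <= (x.1 - c) ^+ 2 + vari x.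
  by have := mean_var [set i0] c f0; rewrite !big_set1 -mulrDr.
have [Y [aYA leY others]] := far_step w g1 (f01 i0) (bxi i0) far vle.
have Y0 : 0 < Y by case/andP: aYA => + _; exact: lt_le_trans.
have near i : i != i0 -> gap k.+1 Y (xi i) <= a^-1.
  move=> ii0; case: others => [h|[gY Tt]].
    by apply: le_trans h; rewrite /gap !lerD2r.
  have t0 := tau_ge; have a0 := a_gt0.
  rewrite (gap_shift _ _ x) (_ : a^-1 = a + stp); last by rewrite /stp; ring.
  rewrite lerD// leNgt; apply/negP => Ti.
  (* Two children displaced by more than [stp] would each contribute more than 1 to the second
     moment about [x.1 - a], whose total is at most [a ^ 2 + 1 < 2]. *)
  have big t : stp < t -> 1 < a ^+ 2 * (t + a) ^+ 2.
    move=> tt; rewrite -exprMn expr_gt1//; last by rewrite mulr_ge0//; lra.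
    by rewrite -ltr_pdivrMl// mulr1; move: tt; rewrite /stp; lra.
  have := mean_var [set i; i0] (x.1 - a) f0.
  have E t : t - (x.1 - a) = t - x.1 + a by ring.
  rewrite !big_setU1 ?inE//= !big_set1 !E mulrDr => h.
  have := big _ Ti; have := big _ Tt; have a1 := a_lt1.
  have := f0 i; have := f0 i0; rewrite subrr add0r in h.
  have : 0 <= a ^+ 2 * (vari (xi i) + vari (xi i0)) by pos.
  have : a ^+ 2 < 1 by rewrite exprn_ilt1// ltW.
  by lra.
rewrite (bigD1 i0)//=; apply: le_trans leY.
rewrite -mean_plane [in leRHS](bigD1 i0)//= -mulrDr ler_wpM2l ?sqr_ge0//.
rewrite [leRHS](_ : _ = bi i0 + \sum_(i | i != i0) plane k.+1 Y (xi i)); last by ring.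
by rewrite lerD2l ler_sum// => i ii0; apply: plane_dom => //; exact: near.
Qed.
End mean.
End planes.

(** * The graph of B *)

Section graph.
Variables (R : realType) (a : R).
Hypotheses (a_gt0 : 0 < a) (a_small : 2 * a ^+ 2 <= 1).
Implicit Types (x z : R * R).

Let sqrta : Num.sqrt (a ^+ 2) = a.
Proof. by rewrite sqrtr_sqr ger0_norm// ltW. Qed.

Lemma tauE : tau (a ^+ 2) = stp a.
Proof using a_gt0. by rewrite /tau sqrta. Qed.

Lemma vari_Tshift c x : vari (Tshift c x) = vari x.
Proof using. by rewrite /vari /Tshift/=; ring. Qed.

Lemma u1E (s : R) : u1 s = uu s.
Proof using. by rewrite /u1 /v1 /uu; move: (s^-1) => y; field. Qed.

Lemma u2E (s : R) : s != 0 -> u2 (a ^+ 2) s = uu (s / a ^+ 2) - stp a.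
Proof using a_gt0.
move=> s0; rewrite /u2 /v2 tauE /uu invf_div; move: (stp a) => t; field.
by rewrite s0 gt_eqF.
Qed.

Lemma graph_bval x b : 0 <= vari x <= 1 -> B_graph (a ^+ 2) x b -> bval a x b.
Proof using a_gt0 a_small.
have a0 : a != 0 by rewrite gt_eqF.
have a1 := a_lt1 a_gt0 a_small; have A1 := ainv_gt1 a_gt0 a_small.
move=> + g; case: g => {x b} [x x1 _|x x1 x2 _|k x y fan _].
- exact: bval_right.
- exact: bval_low.
have xE : vari x = vari (Tshift (- (k%:R * tau (a ^+ 2))) x) by rewrite vari_Tshift.
have gE X : gap a k X x = (Tshift (- (k%:R * tau (a ^+ 2))) x).1 - uu X.
  by rewrite /gap/= tauE; ring.
move: fan xE gE; case: _ y / => s x' + [t /andP[t0 t1] ->] xE gE; rewrite sqrta.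
- move=> /andP[as1 s1]; have s0 : 0 < s by exact: lt_le_trans as1.
  have gEs : gap a k s x = t * s by rewrite gE/= -u1E /u1; ring.
  have vE : vari x = t * (1 + (1 - t) * s ^+ 2).
    by rewrite xE /vari/= /u1; ring.
  have -> : (a ^+ 2) ^+ k * (2^-1 * (1 + s ^+ 2) * (((1 - t) * u1 s + t * v1 s, (1 - t) * u1 s ^+ 2 + t * (v1 s ^+ 2 + 1)).1 - u1 s)) =
      plane a k s x.
    by rewrite /plane gEs vE /u1/= exprM; field; rewrite ?gt_eqF.
  have sV : 1 <= s^-1 by rewrite invf_ge1.
  apply: bval_window => //; split.
  + by rewrite as1 (le_trans s1)// ltW.
  + by rewrite gEs mulr_ge0// ltW.
  + by rewrite gEs ger_pMl.
  + by rewrite gEs (le_trans _ sV)// mulr_ile1// ltW.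
  + by rewrite gEs vE; field; rewrite ?gt_eqF.
- move=> /andP[as1 s1]; have s0 : 0 < s by rewrite (lt_le_trans _ as1)// exprn_gt0.
  set X := s / a ^+ 2; have X0 : 0 < X by rewrite divr_gt0// exprn_gt0.
  have gES : gap a k.+1 X x = t / X.
    rewrite gapS gE/= -addrA [- uu X + _](_ : _ = - u2 (a ^+ 2) s); last first.
      by rewrite u2E ?gt_eqF// -/X; ring.
    by rewrite /u2 /X invf_div; ring.
  have vE : vari x = t * (1 + (1 - t) / X ^+ 2).
    by rewrite xE /vari/= /u2 /X; field; rewrite ?a0 ?gt_eqF.
  have -> : (a ^+ 2) ^+ k * (a ^+ 2 / 2 * (1 + s ^+ 2 / (a ^+ 2) ^+ 2) *
     (((1 - t) * u2 (a ^+ 2) s + t * v2 (a ^+ 2) s,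
       (1 - t) * u2 (a ^+ 2) s ^+ 2 + t * (v2 (a ^+ 2) s ^+ 2 + 1)).1 - u2 (a ^+ 2) s)) =
      plane a k.+1 X x.
    rewrite /plane gES vE /u2/= mulnS exprD -exprM.
    by rewrite /X; move: (a ^+ (2 * k)) => al; field; rewrite ?a0 ?gt_eqF.
  have X1 : 1 <= X by rewrite ler_pdivlMr ?exprn_gt0// mul1r.
  have XA : X <= a^-1.
    rewrite ler_pdivrMr ?exprn_gt0//; apply: le_trans s1 _.
    by rewrite expr2 mulrA mulVf// mul1r.
  have XV : X^-1 <= 1 by rewrite invf_le1.
  apply: bval_window => //; split.
  + by rewrite XA andbT (le_trans (ltW a1)).
  + by rewrite gES divr_ge0// ltW.
  + rewrite gES (le_trans _ X1)// mulr_ile1 ?invr_ge0// ltW//.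
  + by rewrite gES ger_pMl ?invr_gt0.
  + by rewrite gES vE; field; rewrite ?gt_eqF.
Qed.

Lemma window_graph k X z : window a k X z -> (k = 0%N -> X <= 1) ->
  exists b, B_graph (a ^+ 2) z b.
Proof using a_gt0 a_small.
move=> w k0; have a0 : a != 0 by rewrite gt_eqF.
have X0 := window_gt0 a_gt0 w; case: w => /andP[aX XA] D0 DX DXV vE.
have [X1|X1] := leP X 1.
  exists ((a ^+ 2) ^+ k * (2^-1 * (1 + X ^+ 2) *
    ((Tshift (- (k%:R * tau (a ^+ 2))) z).1 - u1 X))).
  apply: B_shift; apply: B_Omega1; first by rewrite sqrta aX.
  exists (gap a k X z / X).
    by rewrite divr_ge0 ?(ltW X0)// ler_pdivrMr// mul1r.
  have z1 : z.1 = gap a k X z + uu X - k%:R * stp a by rewrite /gap; ring.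
  have z2 : z.2 = vari z + z.1 ^+ 2 by rewrite subrK.
  rewrite /Tshift z2 vE z1 tauE -!u1E /u1; congr pair.
    by field; rewrite ?gt_eqF.
  by field; rewrite ?gt_eqF.
move: k0 D0 DX DXV vE; case: k => [/(_ erefl)|k _ D0 DX DXV vE].
  by rewrite leNgt X1.
set s := a ^+ 2 * X; have Xs : s / a ^+ 2 = X by rewrite /s mulrC mulKf// expf_neq0.
have s0 : 0 < s by rewrite mulr_gt0// exprn_gt0.
exists ((a ^+ 2) ^+ k * (a ^+ 2 / 2 * (1 + s ^+ 2 / (a ^+ 2) ^+ 2) *
  ((Tshift (- (k%:R * tau (a ^+ 2))) z).1 - u2 (a ^+ 2) s))).
apply: B_shift; apply: B_Omega2.
  rewrite sqrta /s ler_peMr ?sqr_ge0 ?(ltW X1)//=.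
  by rewrite expr2 -mulrA ger_pMr// -ler_pdivlMl// mulr1.
exists (gap a k.+1 X z * X).
  by rewrite mulr_ge0 ?(ltW X0)//= -ler_pdivlMr// mul1r.
have z1 : z.1 = gap a k.+1 X z + uu X - k.+1%:R * stp a by rewrite /gap; ring.
have z2 : z.2 = vari z + z.1 ^+ 2 by rewrite subrK.
have v2E : v2 (a ^+ 2) s = u2 (a ^+ 2) s + X^-1 by rewrite /u2 -Xs invf_div subrK.
rewrite /Tshift z2 vE z1 v2E u2E ?gt_eqF// Xs tauE -natr1; congr pair.
  by field; rewrite ?gt_eqF.
by field; rewrite ?gt_eqF.
Qed.

(** The smaller root [D] of [D ^ 2 - (X + X^-1) D + f = 0], which is the gap at which the line of
    the segment reaches variance [f]. *)
Let root (f X : R) := 2^-1 * (X + X^-1) - Num.sqrt ((2^-1 * (X + X^-1)) ^+ 2 - f).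

Lemma root_window k X z : a <= X <= a^-1 -> 0 <= vari z <= 1 ->
  root (vari z) X = gap a k X z -> window a k X z.
Proof using a_gt0.
move=> aXA /andP[f0 f1] gE; have X0 : 0 < X by case/andP: aXA => + _; exact: lt_le_trans.
set H := 2^-1 * (X + X^-1); set h := 2^-1 * (X - X^-1).
have H0 : 0 < H by rewrite mulr_gt0// addr_gt0// invr_gt0.
have H1 : H ^+ 2 - 1 = h ^+ 2 by rewrite /H /h; field; rewrite ?gt_eqF.
have r0 : 0 <= H ^+ 2 - vari z by have := sqr_ge0 h; rewrite -H1; lra.
have sE := sqr_sqrtr r0; have s0 := sqrtr_ge0 (H ^+ 2 - vari z).
move: gE; rewrite /root -/H; set s := Num.sqrt _ in s0 sE * => gE.
have sH : s <= H by rewrite -ler_sqr ?nnegrE ?(ltW H0)// sE; lra.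
have sh : `|h| <= s.
  by rewrite -ler_sqr ?nnegrE// real_normK ?num_real// sE -H1; lra.
have Xe : X = H + h by rewrite /H /h; field; rewrite ?gt_eqF.
have Xe' : X^-1 = H - h by rewrite /H /h; field; rewrite ?gt_eqF.
move: sh; rewrite ler_norml => /andP[sh1 sh2].
split => //; rewrite -gE.
- by rewrite subr_ge0.
- by rewrite Xe; lra.
- by rewrite Xe'; lra.
- rewrite (_ : X + X^-1 = 2 * H); last by rewrite {1}Xe Xe'; ring.
  rewrite (_ : vari z = H ^+ 2 - s ^+ 2); last by rewrite sE; ring.
  ring.
Qed.

Lemma root_ivt k X1 X2 z : a <= X1 -> X1 <= X2 -> X2 <= a^-1 -> 0 <= vari z <= 1 ->
  root (vari z) X1 <= gap a k X1 z -> gap a k X2 z <= root (vari z) X2 ->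
  exists2 X, X1 <= X <= X2 & window a k X z.
Proof using a_gt0.
move=> aX1 X12 X2A f01 h1 h2.
have X10 : 0 < X1 by exact: lt_le_trans aX1.
pose f X := root (vari z) X - gap a k X z.
have cf : {within `[X1, X2], continuous f}.
  apply: continuous_in_subspaceT => X /set_mem/=; rewrite in_itv/= => /andP[X1X _].
  have X0 : X != 0 by rewrite gt_eqF// (lt_le_trans X10).
  have cV := inv_continuous X0.
  have cH : {for X, continuous (fun X : R => 2^-1 * (X + X^-1))}.
    by apply: continuousM; [exact: cst_continuous|apply: continuousD].
  apply: continuousB.
    apply: continuousB => //.
    apply: (@continuous_comp _ _ _ _ Num.sqrt); last exact: sqrt_continuous.
    apply: continuousB; last exact: cst_continuous.
    by apply: continuousM.
  rewrite /gap /uu; apply: continuousB; first exact: cst_continuous.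
  apply: continuousB; last exact: cst_continuous.
  by apply: continuousM; [exact: cst_continuous|apply: continuousB].
have f12 : Num.min (f X1) (f X2) <= 0 <= Num.max (f X1) (f X2).
  by rewrite ge_min le_max !subr_le0 !subr_ge0 h1 h2 orbT.
have [X + fX] := IVT X12 cf f12.
rewrite in_itv/= => X12'; exists X => //.
have /andP[X1X XX2] := X12'.
apply: root_window => //; first by rewrite (le_trans aX1)// (le_trans XX2).
by apply/eqP; rewrite -subr_eq0; apply/eqP.
Qed.

Lemma graph_total z : 0 <= vari z <= 1 -> exists b, B_graph (a ^+ 2) z b.
Proof using a_gt0 a_small.
move=> f01; have /andP[f0 f1] := f01.
have a1 := a_lt1 a_gt0 a_small; have A1 := ainv_gt1 a_gt0 a_small.
have t0 : 0 < stp a by apply: lt_le_trans (tau_ge a_gt0 a_small).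
have [z1|/ltW z1] := leP 0 z.1; first by eexists; exact: B_right.
have [z2|/ltW z2] := leP z.2 1; first by eexists; exact: B_low.
have root_aE : root (vari z) a^-1 = root (vari z) a by rewrite /root invrK [a + _]addrC.
have [d0|d0] := leP (root (vari z) a) (gap a 0 a z).
  have [X /andP[aX X1] w] : exists2 X, a <= X <= 1 & window a 0 X z.
    apply: root_ivt => //; [exact: ltW|exact: ltW|].
    have vE : z.2 = vari z + z.1 ^+ 2 by rewrite subrK.
    rewrite /root /gap /uu invr1.
    have -> : 2^-1 * (1 + 1) = 1 :> R by field.
    have s1 : Num.sqrt (1 ^+ 2 - vari z) <= - z.1.
      rewrite -ler_sqr ?nnegrE ?sqrtr_ge0 ?oppr_ge0// sqrrN expr1n sqr_sqrtr ?subr_ge0//.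
      by move: z2; rewrite vE; lra.
    by move: s1; set s := Num.sqrt _ => s1; lra.
  by apply: window_graph w _.
(* Generations recede to the left by [stp], so [z] eventually lies to the right of the last segment
   of one of them. The least such generation contains [z], because [root] agrees at [a] and [a^-1]
   and the previous last segment is the present first one. *)
have [m hm] : exists m, root (vari z) a <= gap a m a z.
  exists (Num.Def.archi_bound ((root (vari z) a - gap a 0 a z) / stp a)).
  rewrite /gap mul0r addr0.
  have := unstable.ltr_bound ((root (vari z) a - gap a 0 a z) / stp a).
  rewrite ltr_pdivrMr// /gap mul0r addr0; lra.
have exm : exists m, root (vari z) a <= gap a m a z by exists m.
case: (ex_minnP exm) => {m hm} -[|m] hm mmin; first by move: d0; rewrite ltNge hm.
have hm' : gap a m a z < root (vari z) a.
  by rewrite ltNge; apply/negP => /mmin; rewrite ltnn.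
have [X aXA w] : exists2 X, a <= X <= a^-1 & window a m.+1 X z.
  apply: root_ivt => //; first by rewrite ltW// (lt_trans a1).
  by rewrite root_aE gap_ainv// ltW.
by apply: window_graph w _.
Qed.
End graph.

(** * Minorants *)

Definition pt_mix {R : realType} (t : R) (p q : R * R) : R * R :=
  ((1 - t) * p.1 + t * q.1, (1 - t) * p.2 + t * q.2).

Section lower.
Variables (R : realType) (a : R) (I : finType) (F : R * R -> R).
Implicit Types (x p q : R * R) (t : R).
Local Notation om x := (0 <= vari x <= 1).
Hypotheses (a_gt0 : 0 < a) (a_small : 2 * a ^+ 2 <= 1).
Hypotheses (aI : a ^+ 2 * #|I|%:R = 1) (evenI : ~~ odd #|I|).
Hypothesis F_ge0 : forall x, om x -> 0 <= F x.
(** The level is 0 here: a mean [x.1 >= 0] at the root takes over as the level, and translating it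
    back to 0 contributes the summand [x.1]. *)
Hypothesis F_right : forall x, om x -> 0 <= x.1 -> x.1 + F (0, vari x) <= F x.
Hypothesis F_mean : forall x (xi : I -> R * R), om x -> (forall i, om (xi i)) ->
  x.1 = a ^+ 2 * \sum_i (xi i).1 -> x.2 = a ^+ 2 * \sum_i (xi i).2 ->
  a ^+ 2 * \sum_i F (xi i) <= F x.

Lemma mean_two (J : {set I}) p q (f : R * R -> R) :
  a ^+ 2 * \sum_i f (if i \in J then q else p) =
  (1 - a ^+ 2 * #|J|%:R) * f p + a ^+ 2 * #|J|%:R * f q.
Proof using aI.
have E : \sum_i f (if i \in J then q else p) =
    f q * #|J|%:R + f p * #|[predC J]|%:R.
  rewrite (bigID (mem J))/=; congr (_ + _).
    by under eq_bigr => i iJ do rewrite iJ; rewrite sumr_const mulr_natr.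
  under eq_bigr => i iJ do rewrite (negbTE iJ).
  by rewrite sumr_const mulr_natr.
have aC : a ^+ 2 * #|J|%:R + a ^+ 2 * #|[predC J]|%:R = 1.
  by rewrite -mulrDr -natrD cardC.
by rewrite E -[X in (X - _) * f p]aC; ring.
Qed.

Lemma half_card : exists J : {set I}, a ^+ 2 * #|J|%:R = 2^-1.
Proof using aI evenI.
have : (0 < #|[set J : {set I} | #|J| == #|I|./2]%SET|)%N.
  by rewrite card_draws bin_gt0 -{2}(odd_double_half #|I|) -addnn addnA leq_addl.
case/card_gt0P => J; rewrite inE => /eqP cJ; exists J; rewrite cJ.
apply: (@mulIf _ 2) => //; rewrite -mulrA mulVf//.
by rewrite -natrM muln2 halfK (negbTE evenI) subn0.
Qed.

Lemma F_card (J : {set I}) p q : om p -> om q -> om (pt_mix (a ^+ 2 * #|J|%:R) p q) ->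
  (1 - a ^+ 2 * #|J|%:R) * F p + a ^+ 2 * #|J|%:R * F q <=
  F (pt_mix (a ^+ 2 * #|J|%:R) p q).
Proof using aI F_mean.
move=> p1 q1 pq1; rewrite -mean_two; apply: F_mean => //.
- by move=> i; case: ifP.
- by rewrite (mean_two _ _ _ fst).
- by rewrite (mean_two _ _ _ snd).
Qed.

Lemma F_mid p q : om p -> om q -> om (pt_mix 2^-1 p q) ->
  2^-1 * (F p + F q) <= F (pt_mix 2^-1 p q).
Proof using aI evenI F_mean.
have [J cJ] := half_card.
have E : 1 - 2^-1 = 2^-1 :> R by field.
by move=> p1 q1 pq1; have := @F_card J p q; rewrite cJ E -mulrDr; exact.
Qed.

Lemma F_one p q : om p -> om q -> om (pt_mix (a ^+ 2) p q) ->
  (1 - a ^+ 2) * F p + a ^+ 2 * F q <= F (pt_mix (a ^+ 2) p q).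
Proof using aI F_mean.
have [i _] : exists i : I, true.
  have [i|I0] := pickP (predT : pred I); first by exists i.
  by move: aI; rewrite (eq_card0 I0) mulr0 => /esym/eqP; rewrite oner_eq0.
by move=> p1 q1 pq1; have := @F_card [set i] p q; rewrite cards1 mulr1; exact.
Qed.

Lemma pt_mix_mid t t1 t2 p q : t = 2^-1 * (t1 + t2) ->
  pt_mix t p q = pt_mix 2^-1 (pt_mix t1 p q) (pt_mix t2 p q).
Proof using.
move=> ->; have E : 1 - 2^-1 = 2^-1 :> R by field.
by rewrite /pt_mix E; congr pair; move=> /=; field.
Qed.

(** Midpoint concavity suffices without any continuity, thanks to [F_ge0]: the inequality holds with
    error [F p + F q] at the start, and writing the point as the midpoint of an end point and
    another point of the segment halves the error. *)
Lemma F_segment p q : (forall t, 0 <= t <= 1 -> om (pt_mix t p q)) ->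
  forall t, 0 <= t <= 1 -> (1 - t) * F p + t * F q <= F (pt_mix t p q).
Proof using aI evenI F_mean F_ge0.
move=> seg01; have E0 : pt_mix 0 p q = p.
  by rewrite /pt_mix subr0 !mul1r !mul0r !addr0; case: p {seg01}.
have E1 : pt_mix 1 p q = q.
  by rewrite /pt_mix subrr !mul1r !mul0r !add0r; case: q {seg01 E0}.
have omp : om p by rewrite -E0; apply: seg01; rewrite lexx ler01.
have omq : om q by rewrite -E1; apply: seg01; rewrite lexx ler01.
have p0 := F_ge0 omp; have q0 := F_ge0 omq.
pose K := F p + F q.
have step m t : 0 <= t <= 1 ->
    (1 - t) * F p + t * F q - 2^-1 ^+ m * K <= F (pt_mix t p q).
  elim: m t => [|m IH] t t01; have /andP[t0 t1] := t01.
    rewrite expr0 mul1r; apply: le_trans (F_ge0 (seg01 _ t01)).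
    by rewrite /K; nra.
  have [th|th] := leP t 2^-1.
    have t2 : 0 <= 2 * t <= 1 by apply/andP; split; lra.
    have e : pt_mix t p q = pt_mix 2^-1 p (pt_mix (2 * t) p q).
      by rewrite (@pt_mix_mid t 0 (2 * t)) ?E0//; field.
    have := F_mid omp (seg01 _ t2); rewrite -e => /(_ (seg01 _ t01)).
    by have := IH _ t2; rewrite exprS; move: (2^-1 ^+ m) => r h1 h2; lra.
  have t2 : 0 <= 2 * t - 1 <= 1 by apply/andP; split; lra.
  have e : pt_mix t p q = pt_mix 2^-1 q (pt_mix (2 * t - 1) p q).
    by rewrite (@pt_mix_mid t 1 (2 * t - 1)) ?E1//; field.
  have := F_mid omq (seg01 _ t2); rewrite -e => /(_ (seg01 _ t01)).
  by have := IH _ t2; rewrite exprS; move: (2^-1 ^+ m) => r h1 h2; lra.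
move=> t t01; apply/ler_addgt0Pr => e e0.
have K0 : 0 <= K by rewrite addr_ge0.
pose m := Num.Def.archi_bound (K / e).
have hm : 2^-1 ^+ m * K <= e.
  rewrite exprVn mulrC ler_pdivrMr ?exprn_gt0// mulrC -ler_pdivrMr//.
  apply: le_trans (ltW (unstable.ltr_bound _)) _; rewrite -natrX ler_nat.
  exact/ltnW/ltn_expl.
by have := step m t t01; lra.
Qed.

(* The segment from [u] to [v] stays in the domain, the one from [v] to [w]
   does not: a step of weight [a ^ 2] towards [w] followed by the segment from
   [u] to [v] gives the jump of any larger weight. *)
Lemma F_jump u v w b : om w -> a ^+ 2 <= b <= 1 -> v = pt_mix b u w ->
  (forall t, 0 <= t <= 1 -> om (pt_mix t u v)) -> b * F w <= F v.
Proof using All.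
move=> w1 /andP[ab b1] vE seg01; have a1 := a_lt1 a_gt0 a_small.
have aa0 : 0 < a ^+ 2 by rewrite exprn_gt0.
have aa1 : a ^+ 2 < 1 by rewrite exprn_ilt1// ltW.
have b0 : 0 < b by lra.
(* The solution of [(1 - a ^ 2) * l * b + a ^ 2 = b], obtained by comparing the weights of [w] in
   the two expressions of [v]. *)
pose l := (1 - a ^+ 2 / b) / (1 - a ^+ 2).
have l01 : 0 <= l <= 1.
  apply/andP; split.
    by rewrite divr_ge0 ?subr_ge0 ?(ltW aa1)// ler_pdivrMr// mul1r.
  by rewrite ler_pdivrMr ?subr_gt0// mul1r lerD2l lerN2 ler_pdivlMr// ger_pMr.
have vy : v = pt_mix (a ^+ 2) (pt_mix l u v) w.
  rewrite vE /pt_mix/= /l; congr pair; field;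
    by rewrite (gt_eqF b0) subr_eq0 (gt_eqF aa1).
have u1 : om u.
  have := seg01 0; rewrite lexx ler01 => /(_ isT).
  by rewrite /pt_mix subr0 !mul1r !mul0r !addr0; case: u {vE seg01 vy}.
have v1 : om v.
  have := seg01 1; rewrite lexx ler01 => /(_ isT).
  by rewrite /pt_mix subrr !mul1r !mul0r !add0r; case: v {vE seg01 vy}.
have := F_one (seg01 _ l01) w1; rewrite -vy => /(_ v1) h1.
have := F_segment seg01 l01; have := F_ge0 u1 => u0 h2.
have h3 : l * F v <= F (pt_mix l u v).
  by apply: le_trans h2; rewrite lerDr mulr_ge0// subr_ge0; case/andP: l01.
have h4 : (1 - a ^+ 2) * (l * F v) + a ^+ 2 * F w <= F v.
  by apply: le_trans h1; rewrite lerD2r ler_pM2l// subr_gt0.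
have : (1 - a ^+ 2) * (l * F v) = F v - a ^+ 2 / b * F v.
  by rewrite /l; field; rewrite (gt_eqF b0) subr_eq0 (gt_eqF aa1).
move=> lE; rewrite lE in h4.
have : a ^+ 2 * F w <= a ^+ 2 / b * F v by lra.
by rewrite -mulrA ler_pM2l// ler_pdivlMl.
Qed.

(** A self-improving estimate for [phi = F (0, c ^ 2)]. Concavity along the horizontal segment from
    [(- c, c ^ 2)] to [(d, c ^ 2)] bounds [phi] below by [F (d, c ^ 2)]. [F_right] brings that back
    to [F (0, c ^ 2 - d ^ 2)], and concavity along the axis back to [phi]. The outcome is
    [c <= phi * (1 + d / c)], and [d] tends to 0. *)
Lemma F_axis c : 0 < c <= 1 -> c <= F (0, c ^+ 2).
Proof using All.
move=> /andP[c0 c1]; have cc1 : c ^+ 2 <= 1 by rewrite exprn_ile1// ltW.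
set phi := F (0, c ^+ 2).
have omv y : 0 <= y <= c -> om (0, y ^+ 2).
  move=> /andP[y0 yc]; rewrite /vari/= expr0n subr0 sqr_ge0 exprn_ile1//.
  exact: le_trans c1.
have phi0 : 0 <= phi by apply/F_ge0/omv; rewrite ltW//=.
have omh y : - c <= y <= c -> om (y, c ^+ 2).
  move=> yc; rewrite /vari/=; have y2 : y ^+ 2 <= c ^+ 2.
    by rewrite -real_normK ?num_real// ler_sqr ?nnegrE ?(ltW c0)// ler_norml.
  by rewrite subr_ge0 y2/= lerBlDr ler_wpDr// sqr_ge0.
have key d : 0 < d <= c -> c <= phi * (1 + d / c).
  move=> /andP[d0 dc].
  have h1 : (c ^+ 2 - d ^+ 2) / c ^+ 2 * phi <= F (0, c ^+ 2 - d ^+ 2).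
    set t := _ / c ^+ 2; have t01 : 0 <= t <= 1.
      rewrite divr_ge0 ?sqr_ge0 ?subr_ge0 ?ler_sqr ?nnegrE ?(ltW d0) ?(ltW c0)//=.
      by rewrite ler_pdivrMr ?exprn_gt0// mul1r gerBl sqr_ge0.
    have <- : pt_mix t (0, 0) (0, c ^+ 2) = (0, c ^+ 2 - d ^+ 2).
      rewrite /pt_mix/= !mulr0 !add0r /t divfK// expf_neq0//.
      by rewrite gt_eqF.
    apply: le_trans (@F_segment (0, 0) (0, c ^+ 2) _ t t01).
      rewrite lerDr mulr_ge0//; first by case/andP: t01 => _; rewrite -subr_ge0.
      by apply: F_ge0; rewrite /vari/= expr0n subr0 lexx ler01.
    move=> s /andP[s0 s1]; rewrite /pt_mix /vari/= !mulr0 !add0r expr0n subr0.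
    by rewrite mulr_ge0 ?sqr_ge0//= mulr_ile1 ?sqr_ge0.
  have h2 : d + F (0, c ^+ 2 - d ^+ 2) <= F (d, c ^+ 2).
    by apply: (F_right (omh d _) (ltW d0)); rewrite dc andbT; lra.
  have h3 : c / (c + d) * F (d, c ^+ 2) <= phi.
    have cd : 0 < c + d by rewrite addr_gt0.
    set t := c / (c + d); have t01 : 0 <= t <= 1.
      by rewrite divr_ge0 ?(ltW cd) ?(ltW c0)//= ler_pdivrMr// mul1r lerDl ltW.
    have e : pt_mix t (- c, c ^+ 2) (d, c ^+ 2) = (0, c ^+ 2).
      rewrite /pt_mix/= -mulrDl subrK mul1r /t; congr pair.
      by field; rewrite gt_eqF.
    rewrite /phi -e; apply: le_trans (@F_segment (- c, c ^+ 2) (d, c ^+ 2) _ t t01).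
      rewrite lerDr mulr_ge0//; first by case/andP: t01 => _; rewrite -subr_ge0.
      by apply/F_ge0/omh; lra.
    move=> s /andP[s0 s1]; rewrite /pt_mix/= -mulrDl subrK mul1r; apply: omh.
    by apply/andP; split; nra.
  have h4 : c / (c + d) * (d + (c ^+ 2 - d ^+ 2) / c ^+ 2 * phi) <= phi.
    apply: le_trans h3; rewrite ler_pM2l ?divr_gt0 ?addr_gt0//.
    by apply: le_trans h2; rewrite lerD2l.
  have cd : 0 < c + d by rewrite addr_gt0.
  have E : c / (c + d) * (d + (c ^+ 2 - d ^+ 2) / c ^+ 2 * phi) =
     phi + d / (c + d) * (c - phi * (1 + d / c)).
    by field; rewrite (gt_eqF cd) (gt_eqF c0).
  move: h4; rewrite E gerDl pmulr_rle0 ?divr_gt0// subr_le0//.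
apply/ler_addgt0Pr => e e0.
pose d := Num.min c (e * c / (phi + 1)).
have p1 : 0 < phi + 1 by rewrite ltr_wpDl.
have d0 : 0 < d <= c.
  by rewrite /d lt_min c0 divr_gt0 ?mulr_gt0//= ge_min lexx.
apply: le_trans (key _ d0) _; rewrite mulrDr mulr1 lerD2l.
rewrite mulrA ler_pdivrMr//.
have : d <= e * c / (phi + 1) by rewrite /d ge_min lexx orbT.
rewrite ler_pdivlMr//; have /andP[d00 _] := d0; nra.
Qed.

Lemma F_right_sqrt x : om x -> 0 <= x.1 -> x.1 + Num.sqrt (vari x) <= F x.
Proof using All.
move=> x01 x1; have /andP[f0 f1] := x01; apply: le_trans (F_right x01 x1).
rewrite lerD2l; have [s0|s0] := eqVneq (Num.sqrt (vari x)) 0.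
  by rewrite s0; apply: F_ge0; rewrite /vari/= expr0n/= subr0.
rewrite -{2}(sqr_sqrtr f0); apply: F_axis.
rewrite lt_def s0 sqrtr_ge0/= -(@expr_le1 _ 2) ?sqrtr_ge0//.
by rewrite sqr_sqrtr.
Qed.

(** The variance along the segment is [t + t * (1 - t) * r ^ 2]; [r <= 1] keeps it at most 1. *)
Lemma om_segment (u r t : R) : 0 <= r <= 1 -> 0 <= t <= 1 ->
  om (pt_mix t (u, u ^+ 2) (u + r, (u + r) ^+ 2 + 1)).
Proof using.
move=> /andP[r0 r1] /andP[t0 t1].
have -> : vari (pt_mix t (u, u ^+ 2) (u + r, (u + r) ^+ 2 + 1)) =
    t + t * (1 - t) * r ^+ 2 by rewrite /vari /pt_mix/=; ring.
have r2 : r ^+ 2 <= 1 by rewrite exprn_ile1.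
have r2' := sqr_ge0 r.
have tt : 0 <= t * (1 - t) by rewrite mulr_ge0// subr_ge0.
by apply/andP; split; nra.
Qed.

Local Notation top v := (v, v ^+ 2 + 1).

Lemma om_top (v : R) : om (top v).
Proof using. by rewrite /vari/= addrAC subrr add0r ler01 lexx. Qed.

Lemma om_bottom (v : R) : om (v, v ^+ 2).
Proof using. by rewrite /vari/= subrr ler01 lexx. Qed.

Lemma F_top_right v : 0 <= v -> v + 1 <= F (top v).
Proof using All.
move=> v0; have := F_right_sqrt (om_top v) v0.
by rewrite {1}/vari/= addrAC subrr add0r sqrtr1.
Qed.

(** For [k = 0] the jump goes to the second point [w >= 0] of the line on the upper boundary, where
    [F_top_right] gives [w + 1]; its weight [X ^ 2] is at least [a ^ 2]. For larger [k], one step of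
    weight [a ^ 2] goes to the upper boundary point at distance [stp], in the previous generation;
    the contribution of the lower boundary is dropped as nonnegative. *)
Lemma F_top k X : a <= X <= a^-1 -> (k = 0%N -> X <= 1) ->
  a ^+ (2 * k) * (2^-1 * X * (X + X^-1) * Num.min X X^-1) <=
  F (top (uu X - k%:R * stp a + Num.min X X^-1)).
Proof using All.
elim: k X => [|k IH] X /andP[aX XA] k0; have X0 : 0 < X by exact: lt_le_trans aX.
  have X1 : X <= 1 by exact: k0.
  have X1V : 1 <= X^-1 by rewrite invf_ge1.
  rewrite min_l ?(le_trans X1)// muln0 expr0 mul1r mul0r subr0.
  set w := 2^-1 * (X + X^-1) - 1.
  have w0 : 0 <= w.
    rewrite /w (_ : _ - _ = (1 - X) ^+ 2 / (2 * X)); last by field; rewrite gt_eqF.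
    by rewrite divr_ge0 ?sqr_ge0// mulr_ge0// ltW.
  have vE : top (uu X + X) = pt_mix (X ^+ 2) (uu X, uu X ^+ 2) (top w).
    by rewrite /pt_mix/= /uu /w; congr pair; field; rewrite gt_eqF.
  have b01 : a ^+ 2 <= X ^+ 2 <= 1.
    by rewrite ler_sqr ?nnegrE ?(ltW a_gt0) ?(ltW X0)// aX exprn_ile1// ltW.
  have := F_jump (om_top w) b01 vE => h; apply: le_trans (h _); last first.
    by move=> t t01; apply: om_segment => //; rewrite (ltW X0).
  apply: le_trans (_ : X ^+ 2 * (w + 1) <= _).
    by rewrite /w subrK le_eqVlt; apply/orP; left; apply/eqP; ring.
  by rewrite ler_pM2l ?exprn_gt0// F_top_right.
set r := Num.min X X^-1; set v := uu X - k.+1%:R * stp a + r.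
have vE : top v = pt_mix (a ^+ 2) (v - a, (v - a) ^+ 2) (top (v + stp a)).
  by rewrite /pt_mix/= /stp; congr pair; field; rewrite gt_eqF.
have h : a ^+ 2 * F (top (v + stp a)) <= F (top v).
  have := F_one (om_bottom (v - a)) (om_top (v + stp a)); rewrite -vE => /(_ (om_top v)) h1.
  apply: le_trans h1; rewrite lerDr mulr_ge0//; last exact/F_ge0/om_bottom.
  have a1 := a_lt1 a_gt0 a_small.
  by rewrite subr_ge0 exprn_ile1 ?ltW.
apply: le_trans h; rewrite mulnS exprD -mulrA ler_pM2l ?exprn_gt0//.
have -> : v + stp a = uu X - k%:R * stp a + r by rewrite /v -natr1; ring.
have [kX|] := boolP ((k == 0%N) ==> (X <= 1)).
  by apply: IH; [rewrite aX|move=> kE; move: kX; rewrite kE].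
(* From Omega_2 the step already lands in the first branch, so [F_top_right] replaces the induction
   hypothesis. *)
rewrite negb_imply -ltNge => /andP[/eqP-> X1].
have rE : r = X^-1 by rewrite /r min_r// (le_trans _ (ltW X1))// invf_le1// ltW.
rewrite -/r rE mul0r subr0 muln0 expr0 mul1r.
apply: le_trans (F_top_right _).
  rewrite /uu le_eqVlt; apply/orP; left; apply/eqP.
  by field; rewrite gt_eqF.
rewrite /uu (_ : _ + _ = (1 - X) ^+ 2 / (2 * X)); last by field; rewrite gt_eqF.
by rewrite divr_ge0 ?sqr_ge0// mulr_ge0// ltW.
Qed.

Lemma F_bval x b : om x -> bval a x b -> b <= F x.
Proof using All.
move=> x01 bx; case: bx x01 => [x1|x1 x2|k X w k0] x01.
- exact: F_right_sqrt.
- have /andP[f0 f1] := x01.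
  have x20 : 0 <= x.2 by move: f0; have := sqr_ge0 x.1; rewrite /vari; lra.
  have cE := sqr_sqrtr x20; have c0 := sqrtr_ge0 x.2.
  set c := Num.sqrt _ in cE c0 *.
  have xc : - c <= x.1 by rewrite lerNl -ler_sqr ?nnegrE ?oppr_ge0// sqrrN cE; move: f0; rewrite /vari; lra.
  have [c00|c00] := eqVneq c 0.
    by apply: le_trans (F_ge0 x01); rewrite c00 addr0.
  have c01 : 0 < c <= 1 by rewrite lt_def c00 c0 -(@expr_le1 _ 2)// cE.
  set t := (x.1 + c) / c; have t01 : 0 <= t <= 1.
    apply/andP; split; first by rewrite divr_ge0//; lra.
    by rewrite ler_pdivrMr ?mul1r ?gerDr//; case/andP: c01.
  have xE : x = pt_mix t (- c, c ^+ 2) (0, c ^+ 2).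
    rewrite /pt_mix/= -mulrDl subrK mul1r cE [LHS]surjective_pairing; congr pair.
    by rewrite /t; field.
  have omh y : - c <= y <= 0 -> om (y, c ^+ 2).
    move=> /andP[y1 y0]; rewrite /vari/= cE.
    have y2 : y ^+ 2 <= x.2.
      by rewrite -cE -sqrrN ler_sqr ?nnegrE ?oppr_ge0//; lra.
    by have := sqr_ge0 y; lra.
  rewrite xE; apply: le_trans (@F_segment (- c, c ^+ 2) (0, c ^+ 2) _ t t01).
    rewrite -xE; apply: le_trans (_ : t * F (0, c ^+ 2) <= _).
      rewrite (_ : x.1 + c = t * c); last by rewrite /t divfK.
      by rewrite ler_wpM2l ?F_axis//; case/andP: t01.
    rewrite lerDr mulr_ge0//; first by case/andP: t01 => _; rewrite -subr_ge0.
    by apply/F_ge0/omh; lra.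
  move=> s /andP[s0 s1]; rewrite /pt_mix/= -mulrDl subrK mul1r mulr0 addr0.
  by apply: omh; apply/andP; split; nra.
have X0 := window_gt0 a_gt0 w; have [aXA D0 DX DXV vE] := w.
set r := Num.min X X^-1; set u := uu X - k%:R * stp a.
have r0 : 0 < r by rewrite lt_min X0 invr_gt0.
have Dr : gap a k X x <= r by rewrite le_min DX.
have rE : (X + X^-1) * r = r ^+ 2 + 1.
  by rewrite /r /Num.min; case: ifP => _; field; rewrite gt_eqF.
have r1 : r <= 1.
  rewrite /r ge_min; have [//|X1] := leP X 1.
  by rewrite invf_le1// ltW.
have r01 : 0 <= r <= 1 by rewrite (ltW r0).
set t := gap a k X x / r; have tr : t * r = gap a k X x by rewrite /t divfK// gt_eqF.
have t01 : 0 <= t <= 1 by rewrite divr_ge0 ?(ltW r0)//= ler_pdivrMr// mul1r.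
have xE : x = pt_mix t (u, u ^+ 2) (u + r, (u + r) ^+ 2 + 1).
  have x1 : x.1 = u + gap a k X x by rewrite /u /gap; ring.
  have x2 : x.2 = vari x + x.1 ^+ 2 by rewrite subrK.
  rewrite /pt_mix/= [LHS]surjective_pairing; congr pair.
    by rewrite x1 -tr; ring.
  rewrite x2 vE x1 -tr; rewrite (_ : (X + X^-1) * (t * r) = t * (r ^+ 2 + 1)); last first.
    by rewrite -rE; ring.
  by ring.
rewrite {2}xE; apply: le_trans (F_segment _ t01); last by move=> s s01; apply: om_segment.
apply: le_trans (_ : t * F (top (u + r)) <= _); last first.
  rewrite lerDr mulr_ge0//; last exact/F_ge0/om_bottom.
  by case/andP: t01 => _; rewrite subr_ge0.
apply: le_trans (ler_wpM2l _ (F_top aXA k0)); last by case/andP: t01.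
rewrite /plane vE -/r -tr le_eqVlt; apply/orP; left; apply/eqP; ring.
Qed.
End lower.

(** * Trees of averages *)

Section trees.
Variables (R : realType) (n : nat).
Hypothesis n_ge1 : (1 <= n)%N.
Local Notation om x := (0 <= vari x <= 1).
Local Notation idx := {ffun 'I_n -> bool}.

(* A tree records the averages of (phi, phi ^ 2) over some generations of dyadic
   subcubes: [pt] is the average over the whole cube, [flat] says that phi is
   constant on the cubes of the leaves, and [tree_val L] is the mean of the
   maximum of L and the averages of phi met on the way to a leaf. *)
Inductive tree := Leaf of R * R | Node of (idx -> tree).
Implicit Types (t : tree) (x : R * R) (L : R).

Definition rt : R := Num.sqrt (2 ^- n).

Lemma rt_gt0 : 0 < rt.
Proof using. by rewrite sqrtr_gt0 invr_gt0 exprn_gt0. Qed.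

Lemma rt2 : rt ^+ 2 = 2 ^- n.
Proof using. by rewrite sqr_sqrtr// invr_ge0 exprn_ge0. Qed.

Lemma rt_small : 2 * rt ^+ 2 <= 1.
Proof using n_ge1.
rewrite rt2 ler_pdivrMr ?exprn_gt0// mul1r -[leLHS]expr1 ler_eXn2l//.
by rewrite ltr1n.
Qed.

Lemma card_idx : #|idx| = (2 ^ n)%N.
Proof using. by rewrite card_ffun card_bool card_ord. Qed.

Lemma rt_card : rt ^+ 2 * #|idx|%:R = 1.
Proof using. by rewrite rt2 card_idx natrX mulVf// expf_neq0. Qed.

Lemma even_idx : ~~ odd #|idx|.
Proof using n_ge1. by rewrite card_idx oddX/= orbF -lt0n. Qed.

Fixpoint pt t : R * R :=
  match t with
  | Leaf p => p
  | Node s => (rt ^+ 2 * \sum_e (pt (s e)).1, rt ^+ 2 * \sum_e (pt (s e)).2)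
  end.

Fixpoint valid t : Prop :=
  match t with
  | Leaf p => om p
  | Node s => om (pt (Node s)) /\ forall e, valid (s e)
  end.

Fixpoint flat t : Prop :=
  match t with
  | Leaf p => p.2 = p.1 ^+ 2
  | Node s => forall e, flat (s e)
  end.

Fixpoint tree_val L t : R :=
  match t with
  | Leaf p => Num.max L p.1
  | Node s => rt ^+ 2 * \sum_e tree_val (Num.max L (pt (Node s)).1) (s e)
  end.

Lemma valid_om t : valid t -> om (pt t).
Proof using. by case: t => [p|s []]. Qed.

Lemma mean_const c : rt ^+ 2 * \sum_(e : idx) c = c.
Proof using.
rewrite sumr_const -mulr_natr; transitivity (c * (rt ^+ 2 * #|idx|%:R)); first by ring.
by rewrite rt_card mulr1.
Qed.

Lemma tree_val_max L t : tree_val L t = tree_val (Num.max L (pt t).1) t.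
Proof using.
by case: t => [p|s] /=; rewrite -maxA maxxx.
Qed.

Lemma tree_val_ge L t : L <= tree_val L t.
Proof using.
elim: t L => [p|s IH] L /=; first by rewrite le_max lexx.
rewrite -[leLHS]mean_const ler_wpM2l ?sqr_ge0// ler_sum// => e _.
by apply: le_trans (IH e _); rewrite le_max lexx.
Qed.

Lemma le_tree_val L L' t : L <= L' -> tree_val L t <= tree_val L' t.
Proof using.
elim: t L L' => [p|s IH] L L' LL' /=; first by rewrite ge_max !le_max LL' lexx orbT.
rewrite ler_wpM2l ?sqr_ge0// ler_sum// => e _; apply: IH.
by rewrite ge_max !le_max LL' lexx orbT.
Qed.

Lemma bval_ge0 z b : om z -> bval rt z b -> 0 <= b.
Proof using.
have a0 := rt_gt0.
move=> /andP[f0 f1] [z1|z1 z2|k X w _].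
- by rewrite addr_ge0// sqrtr_ge0.
- have : Num.sqrt (z.1 ^+ 2) <= Num.sqrt z.2.
    by rewrite ler_wsqrtr// -subr_ge0.
  by rewrite sqrtr_sqr ler0_norm// => h; lra.
- have X0 := window_gt0 a0 w.
  by rewrite /plane; pos.
Qed.

Lemma bval_right_inv z b : om z -> bval rt z b -> 0 < z.1 ->
  b = z.1 + Num.sqrt (vari z).
Proof using n_ge1.
move=> /andP[f0 f1] [//|z1 _|k X w k0]; first by rewrite ltNge z1.
by have [z1 _] := window_out rt_gt0 rt_small w k0 f0; rewrite ltNge z1.
Qed.

Lemma bval_total z : om z -> exists b, bval rt z b.
Proof using n_ge1.
move=> z1; have [b gb] := graph_total rt_gt0 rt_small z1.
by exists b; apply: graph_bval gb; [exact: rt_gt0|exact: rt_small|].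
Qed.

Lemma tree_val_le t L b : valid t -> bval rt (Tshift L (pt t)) b -> tree_val L t <= L + b.
Proof using n_ge1.
elim: t L b => [p|s IH] L b vt.
  have pt1 : om (Tshift L p) by rewrite vari_Tshift.
  move=> /[dup] bb /(bval_ge0 pt1) b0; rewrite ge_max lerDl b0/=.
  have [pL|Lp] := leP p.1 L; first by rewrite ler_wpDr.
  rewrite (bval_right_inv pt1 bb) ?subr_gt0//.
  have := sqrtr_ge0 (vari (Tshift L p)); have -> : (Tshift L p).1 = p.1 - L by [].
  by move=> s0; lra.
have [p1 vs] := vt; set p := pt (Node s) in p1 *.
have omT (c : R) (q : R * R) : om q -> om (Tshift c q) by rewrite vari_Tshift.
have step c b' : bval rt (Tshift c p) b' ->
    rt ^+ 2 * \sum_e tree_val c (s e) <= c + b'.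
  move=> bb'.
  have ex e : exists b, bval rt (Tshift c (pt (s e))) b.
    by apply: bval_total; exact/omT/valid_om/vs.
  pose bs e : R := xget 0 [set b | bval rt (Tshift c (pt (s e))) b].
  have bsP e : bval rt (Tshift c (pt (s e))) (bs e).
    exact: (xgetPex 0 (ex e)).
  apply: (@le_trans _ _ (rt ^+ 2 * \sum_e (c + bs e))).
    by rewrite ler_wpM2l ?sqr_ge0// ler_sum// => e _; exact: IH (vs e) (bsP e).
  rewrite big_split/= mulrDr mean_const lerD2l.
  apply: (@main_ineq _ _ rt_gt0 rt_small _ (Tshift c p)
    (fun e => Tshift c (pt (s e))) rt_card _ _ b' bs (omT c p p1) _ bb' bsP).
  - transitivity (- c + 1 * p.1 + 0 * p.2); first by rewrite /Tshift/=; ring.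
    rewrite -(mean_affine rt_card (erefl p.1) (erefl p.2)); congr (_ * _).
    by apply: eq_bigr => e _; rewrite /Tshift/=; ring.
  - transitivity (c ^+ 2 + (- 2 * c) * p.1 + 1 * p.2); first by rewrite /Tshift/=; ring.
    rewrite -(mean_affine rt_card (erefl p.1) (erefl p.2)); congr (_ * _).
    by apply: eq_bigr => e _; rewrite /Tshift/=; ring.
  - by move=> e; exact/omT/valid_om/vs.
move=> bb; rewrite [leLHS]/= -/p.
(* When the mean at the root exceeds [L] it becomes the level itself, and the translated root then
   lies on the axis, where B is the square root of the variance. *)
have [pL|Lp] := leP p.1 L; first exact: step.
have /step : bval rt (Tshift p.1 p) ((Tshift p.1 p).1 + Num.sqrt (vari (Tshift p.1 p))).
  by apply: bval_right; rewrite /= subrr.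
move=> h; apply: le_trans h _; rewrite (bval_right_inv (omT L p p1) bb) ?subr_gt0//.
by rewrite !vari_Tshift /= subrr add0r addrA [L + _]addrC subrK.
Qed.

Fixpoint shift (c : R) t : tree :=
  match t with
  | Leaf p => Leaf (Tshift (- c) p)
  | Node s => Node (fun e => shift c (s e))
  end.

Lemma pt_shift c t : pt (shift c t) = Tshift (- c) (pt t).
Proof using.
elim: t => [//|s IH] /=; rewrite /Tshift/=; congr pair.
  under eq_bigr do rewrite IH /=.
  by rewrite big_split/= mulrDr mean_const.
under eq_bigr do rewrite IH /=.
by rewrite !big_split/= !mulrDr mean_const sumrN -mulr_sumr; ring.
Qed.

Lemma flat_shift c t : flat t -> flat (shift c t).
Proof using.
elim: t => [p|s IH] /= ft; first by rewrite ft; ring.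
by move=> e; exact/IH/ft.
Qed.

Lemma valid_shift c t : valid t -> valid (shift c t).
Proof using.
elim: t => [p|s IH]; first by move=> p1; change (is_true (om (Tshift (- c) p))); rewrite vari_Tshift.
move=> [p1 vs]; split; last by move=> e; exact/IH/vs.
by rewrite -[Node _]/(shift c (Node s)) pt_shift vari_Tshift.
Qed.

Lemma tree_val_shift c L t : tree_val (L + c) (shift c t) = tree_val L t + c.
Proof using.
elim: t L => [p|s IH] L; first by rewrite /= opprK addr_maxl.
transitivity (rt ^+ 2 *
    \sum_e tree_val (Num.max (L + c) (pt (shift c (Node s))).1) (shift c (s e))) => //.
rewrite pt_shift; set m := (pt (Node s)).1.
have -> : Num.max (L + c) (Tshift (- c) (pt (Node s))).1 = Num.max L m + c.
  by rewrite addr_maxl/= opprK.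
under eq_bigr do rewrite IH.
by rewrite big_split/= mulrDr mean_const.
Qed.

(** Level 0 only; the other levels are reached through [tree_val_shift]. *)
Definition tree_vals x : set R :=
  [set tree_val 0 t | t in [set t | [/\ valid t, flat t & pt t = x]]].

Definition tree_sup x := sup (tree_vals x).

Lemma tree_vals_sup x : om x -> has_sup (tree_vals x).
Proof using n_ge1.
move=> /andP[f0 f1]; split; last first.
  have [b bb] := bval_total (introT andP (conj f0 f1)).
  exists b => _ [t [vt _ tx] <-]; rewrite -[b]add0r; apply: tree_val_le => //.
  rewrite tx (_ : Tshift 0 x = x)//.
  by rewrite /Tshift; case: x {f0 f1 bb tx} => x1 x2 /=; congr pair; ring.
have [J cJ] := half_card rt_card even_idx.
pose d := Num.sqrt (vari x).
(* A two-valued witness: half of the children at each of the means [x.1 + d] and [x.1 - d], with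
   variance 0. *)
pose q := (x.1 + d, (x.1 + d) ^+ 2); pose p := (x.1 - d, (x.1 - d) ^+ 2).
have d2 : d ^+ 2 = vari x by rewrite sqr_sqrtr.
have pqx : pt_mix 2^-1 p q = x.
  rewrite [RHS]surjective_pairing /pt_mix/=; congr pair; first by field.
  have -> : x.2 = d ^+ 2 + x.1 ^+ 2 by rewrite d2 subrK.
  by field.
pose t := Node (fun e => Leaf (if e \in J then q else p)).
have tE : pt t = x.
  rewrite -pqx /t/=; rewrite -cJ /pt_mix.
  by rewrite -(mean_two rt_card J p q fst) -(mean_two rt_card J p q snd).
exists (tree_val 0 t), t => //; split=> //.
  split; first by rewrite -/t tE f0.
  by move=> e /=; case: ifP => _; rewrite /vari/= subrr lexx ler01.
by move=> e /=; case: ifP.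
Qed.

Lemma tree_sup_ge x t : valid t -> flat t -> pt t = x -> tree_val 0 t <= tree_sup x.
Proof using n_ge1.
move=> vt ft tx; have x1 : om x by rewrite -tx; exact: valid_om.
by apply: sup_upper_bound; [exact: tree_vals_sup|exists t].
Qed.

Lemma tree_sup_ex x e : om x -> 0 < e ->
  exists t, [/\ valid t, flat t, pt t = x & tree_sup x - e < tree_val 0 t].
Proof using n_ge1.
move=> x1 e0; have [_ [t [vt ft tx] <-] h] := sup_adherent e0 (tree_vals_sup x1).
by exists t.
Qed.

Lemma tree_sup_bval x b : om x -> bval rt x b -> b <= tree_sup x.
Proof using n_ge1.
apply: (F_bval rt_gt0 rt_small rt_card even_idx) => {x b}.
- move=> x x1; have [t [vt ft tx _]] := tree_sup_ex x1 ltr01.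
  by apply: le_trans (tree_sup_ge vt ft tx); exact: tree_val_ge.
- move=> x x1 x10; apply/ler_addgt0Pr => e e0.
  have x1' : om (0, vari x) by rewrite [vari (0, _)]/vari/= expr0n/= subr0.
  have [t [vt ft tx lt]] := tree_sup_ex x1' e0.
  have : tree_val 0 (shift x.1 t) <= tree_sup x.
    apply: tree_sup_ge; [exact: valid_shift|exact: flat_shift|].
    rewrite pt_shift tx /Tshift/= [RHS]surjective_pairing; congr pair.
      by rewrite opprK add0r.
    by rewrite /vari; ring.
  rewrite tree_val_max pt_shift tx /Tshift/= sub0r opprK max_r//.
  by rewrite -{1}[x.1]add0r tree_val_shift; lra.
- move=> x xi x1 xi1 xE1 xE2; apply/ler_addgt0Pr => e e0.
  have [ts tsP] := choice (fun i => tree_sup_ex (xi1 i) e0).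
  have tE : pt (Node ts) = x.
    rewrite [RHS]surjective_pairing xE1 xE2 /=; congr pair; congr (_ * _);
      by apply: eq_bigr => i _; have [_ _ -> _] := tsP i.
  apply: le_trans (_ : tree_val 0 (Node ts) + e <= _); last first.
    rewrite lerD2r; apply: (tree_sup_ge _ _ tE); last by move=> i; have [] := tsP i.
    by split; [rewrite tE|move=> i; have [] := tsP i].
  rewrite [tree_val _ _]/= -[X in _ + X]mean_const -mulrDr ler_wpM2l ?sqr_ge0//.
  rewrite -big_split/= ler_sum// => i _; have [_ _ _ /ltW] := tsP i.
  rewrite lerBlDr => hi; apply: le_trans hi _; rewrite lerD2r; apply: le_tree_val.
  by rewrite le_max lexx.
Qed.

Lemma tree_val_ex L x b e : om x -> bval rt (Tshift L x) b -> 0 < e ->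
  exists t, [/\ valid t, flat t, pt t = x & L + b - e < tree_val L t].
Proof using n_ge1.
move=> x1 bb e0; have x1' : om (Tshift L x) by rewrite vari_Tshift.
have [t [vt ft tx lt]] := tree_sup_ex x1' e0.
exists (shift L t); split; [exact: valid_shift|exact: flat_shift| |].
  by rewrite pt_shift tx /Tshift/= [RHS]surjective_pairing; congr pair; ring.
rewrite -[X in tree_val X _]add0r tree_val_shift.
by have := tree_sup_bval x1' bb; lra.
Qed.
End trees.

(** * Dyadic cubes *)

Section geometry.
Variables (R : realType) (n : nat).
Local Notation idx := {ffun 'I_n -> bool}.
Local Notation mu := (@lebesgue_measure_n R n).
Local Notation dcube := (@dyadic_cube R n).
Implicit Types (k : int) (m : 'I_n -> int) (p : Rn R n) (e : idx).

Definition dy k (j : int) : R := 2 ^ k * j%:~R.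

Lemma two_gt0 k : 0 < (2 : R) ^ k.
Proof. exact: exprz_gt0. Qed.

Lemma dy_half k j : dy k j = dy (k - 1) (2 * j).
Proof.
rewrite /dy -{1}(subrK 1 k) expfzDr// expr1z intrM; ring.
Qed.

Lemma dyE k (d : nat) j : dy (k + d%:Z) j = dy k (2 ^+ d * j).
Proof. by rewrite /dy expfzDr// -exprnP intrM rmorphXn/= mulrA. Qed.

Lemma dy_lt k i j : (dy k i < dy k j) = (i < j).
Proof. by rewrite /dy ltr_pM2l ?two_gt0// ltr_int. Qed.

Lemma dy_le k i j : (dy k i <= dy k j) = (i <= j).
Proof. by rewrite /dy ler_pM2l ?two_gt0// ler_int. Qed.

Lemma nested_interval k (d : nat) i j (x : R) :
  dy k i < x < dy k (i + 1) ->
  dy (k + d%:Z) j < x < dy (k + d%:Z) (j + 1) ->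
  dy (k + d%:Z) j <= dy k i /\ dy k (i + 1) <= dy (k + d%:Z) (j + 1).
Proof.
move=> /andP[x1 x2] /andP[x3 x4].
have := lt_trans x3 x2; have := lt_trans x1 x4; rewrite !dyE !dy_lt !dy_le => h1 h2.
by rewrite -ltzD1 h2 lezD1.
Qed.

Definition child m e : 'I_n -> int := fun i => 2 * m i + (e i : nat)%:Z.

Definition half_of k m p : idx := [ffun i => dy (k - 1) (2 * m i + 1) < tnth p i].

(* Off this null set, every point of a dyadic cube lies in one of its children. *)
Definition grid : set (Rn R n) := [set p | exists i k j, tnth p i = dy k j].

Definition cube k m : set (Rn R n) := dcube k m `\` grid.

Lemma cube_sub k m : cube k m `<=` dcube k m.
Proof. by move=> p []. Qed.

Lemma dyadic_nested k (d : nat) m m' p : dcube (k + d%:Z) m p ->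
  dcube k m' p -> dcube k m' `<=` dcube (k + d%:Z) m.
Proof.
move=> mp m'p q qk' i; have [h1 h2] := nested_interval (m'p i) (mp i).
have /andP[h3 h4] := qk' i.
by rewrite -/(dy _ _) -/(dy _ _) (le_lt_trans h1)//= (lt_le_trans h4).
Qed.

Lemma child_sub k m e : dcube (k - 1) (child m e) `<=` dcube k m.
Proof.
move=> p h i; have /andP[h1 h2] := h i.
rewrite -/(dy _ _) -/(dy _ _) !(dy_half k); apply/andP; split.
  by apply: le_lt_trans h1; rewrite -/(dy _ _) dy_le /child lerDl.
apply: lt_le_trans h2 _; rewrite -/(dy _ _) dy_le /child mulrDr mulr1 -addrA lerD2l.
by case: (e i).
Qed.

Lemma half_ofE k m e p : dcube (k - 1) (child m e) p -> half_of k m p = e.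
Proof.
move=> h; apply/ffunP => i; rewrite ffunE; have /andP[] := h i.
rewrite -!/(dy _ _) /child; case: (e i) => h1 h2; first by [].
by apply/negbTE; rewrite -leNgt; apply: ltW; rewrite addr0 in h2.
Qed.

Lemma half_ofP k m p : cube k m p -> dcube (k - 1) (child m (half_of k m p)) p.
Proof.
move=> [h gp] i; have /andP[] := h i; rewrite -!/(dy _ _) !(dy_half k) => h1 h2.
rewrite /child ffunE; have [h3|h3] := ltP (dy (k - 1) (2 * m i + 1)) (tnth p i).
  by rewrite h3/= -addrA; move: h2; rewrite mulrDr.
rewrite addr0 h1 lt_neqAle h3 andbT; apply/eqP => h4; apply: gp.
by exists i, (k - 1), (2 * m i + 1).
Qed.

Lemma cube_child k m e p : cube (k - 1) (child m e) p <->
  cube k m p /\ half_of k m p = e.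
Proof.
split=> [[h gp]|[h <-]].
  by split; [split => //; exact: child_sub h|exact: half_ofE].
by split; [exact: half_ofP|case: h].
Qed.

Lemma cubeU k m : cube k m = \big[setU/set0]_(e <- enum idx) cube (k - 1) (child m e).
Proof.
rewrite -bigcup_seq; apply/seteqP; split => [p h|p [e _ /cube_child[]]//].
by exists (half_of k m p); [rewrite /= mem_enum|exact/cube_child].
Qed.

Lemma trivIset_cube k m : trivIset [set` enum idx] (fun e => cube (k - 1) (child m e)).
Proof.
by apply/trivIsetP => e1 e2 _ _ e12; apply/seteqP; split => // p
  [/cube_child[_ h1] /cube_child[_ h2]]; move: e12; rewrite -h1 -h2 eqxx.
Qed.

Lemma measurable_dyadic k m : measurable (dcube k m : set (Rn R n)).
Proof.
rewrite (_ : dcube k m = \big[setI/setT]_(i < n)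
    ((fun t : Rn R n => tnth t i) @^-1` `]dy k (m i), dy k (m i + 1)[)).
  apply: bigsetI_measurable => i _; rewrite -[X in measurable X]setTI.
  exact: measurable_tnth.
rewrite -bigcap_seq; apply/seteqP; split => t /= h i.
  by move=> _; rewrite /= in_itv/=; exact: h.
by have := h i; rewrite /= mem_index_enum in_itv; exact.
Qed.

Lemma measure_dyadic k m : mu (dcube k m) = ((2 ^ k) ^+ n)%:E.
Proof.
rewrite (_ : dcube k m =
   [set t | forall i, `]dy k (m i), dy k (m i + 1)[%classic (tnth t i)]); last first.
  by apply/seteqP; split => t h i; have := h i; rewrite /= in_itv.
rewrite (lebesgue_measure_n_box (A := fun i => `]dy k (m i), dy k (m i + 1)[%classic))//.
under eq_bigr => i _.
  rewrite lebesgue_measure_itv/= lte_fin dy_lt ltzD1 lexx -EFinD.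
  rewrite (_ : _ - _ = 2 ^ k); last by rewrite /dy intrD; ring.
  over.
by rewrite prodEFin prodr_const card_ord.
Qed.

Lemma grid_null : measurable grid /\ mu grid = 0%E.
Proof.
pose G (u : 'I_n * int * int) : set (Rn R n) := [set p | tnth p u.1.1 = dy u.1.2 u.2].
have mG u : measurable (G u).
  rewrite (_ : G u = (fun t : Rn R n => tnth t u.1.1) @^-1` [set dy u.1.2 u.2])//.
  by rewrite -[X in measurable X]setTI; exact: measurable_tnth.
have G0 u : mu (G u) = 0%E.
  rewrite (_ : G u = [set t | forall i,
      (if i == u.1.1 then [set dy u.1.2 u.2] else setT) (tnth t i)]); last first.
    apply/seteqP; split => t /=; first by move=> h i; case: eqP => [->|].
    by move=> /(_ u.1.1); rewrite eqxx.
  rewrite (lebesgue_measure_n_box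
    (A := fun i => if i == u.1.1 then [set dy u.1.2 u.2] else setT)); last first.
    by move=> i; case: ifP => _ //; exact: measurable_set1.
  by rewrite (bigD1 u.1.1)//= eqxx lebesgue_measure_set1 mul0e.
have gridE : grid = \bigcup_u G u.
  apply/seteqP; split => [p [i [k [j h]]]|p [[[i k] j] _ h]].
    by exists (i, k, j).
  by exists i, k, j.
rewrite gridE; split; first exact: countable_bigcupT_measurable.
have : mu.-negligible (\bigcup_u G u).
  pose f (q : nat) := if unpickle q is Some u then G u else set0.
  rewrite (_ : \bigcup_u G u = \bigcup_q f q); last first.
    apply/seteqP; split => [p [u _ h]|p [q _]].
      by exists (pickle u); rewrite // /f pickleK.
    by rewrite /f; case: unpickle => // u h; exists u.
  apply: negligible_bigcup => q; rewrite /f; case: unpickle => [u|].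
    by exists (G u); split; [exact: mG|exact: G0|].
  exact: negligible_set0.
by move/negligibleP => ->//; exact: countable_bigcupT_measurable.
Qed.

Lemma measurable_cube k m : measurable (cube k m).
Proof. by apply: measurableD; [exact: measurable_dyadic|case: grid_null]. Qed.
End geometry.

(** * Step functions of trees *)

Section steps.
Variables (R : realType) (n : nat).
Hypothesis n_ge1 : (1 <= n)%N.
Local Notation idx := {ffun 'I_n -> bool}.
Local Notation mu := (@lebesgue_measure_n R n).
Local Notation dcube := (@dyadic_cube R n).
Local Notation cube := (@cube R n).
Local Notation half_of := (@half_of R n).
Implicit Types (k : int) (m : 'I_n -> int) (p : Rn R n) (e : idx) (t : tree R n).
Implicit Types (f : Rn R n -> R) (g : Rn R n -> \bar R).

Definition vol k : R := (2 ^ k) ^+ n.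

Lemma vol_gt0 k : 0 < vol k.
Proof. by rewrite exprn_gt0// two_gt0. Qed.

Lemma vol_half k : vol (k - 1) = rt R n ^+ 2 * vol k.
Proof.
have E : (2 : R) ^ k = 2 ^ (k - 1) * 2 by rewrite -{1}(subrK 1 k) expfzDr// expr1z.
by rewrite rt2 /vol E exprMn mulrCA mulVf ?mulr1.
Qed.

Lemma measure_cube k m : mu (cube k m) = (vol k)%:E.
Proof.
have [mg g0] := grid_null R n.
have mD := @measurable_dyadic R n k m.
have fD : (mu (dcube k m) < +oo)%E by rewrite measure_dyadic ltry.
rewrite /cube measureD// [X in (_ - X)%E](_ : _ = 0%E).
  by rewrite sube0; exact: measure_dyadic.
by apply/eqP; rewrite eq_le measure_ge0 andbT -g0 le_measure ?inE//; exact: measurableI.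
Qed.

Lemma integral_cubeE k m g : measurable_fun setT g ->
  (\int[mu]_(p in dcube k m) g p = \int[mu]_(p in cube k m) g p)%E.
Proof.
move=> mg; have [mG g0] := grid_null R n.
have mD := @measurable_dyadic R n k m; have mC := @measurable_cube R n k m.
have mN : measurable (dcube k m `&` @grid R n) by exact: measurableI.
rewrite -[in LHS](setUIDK (dcube k m) (@grid R n)) setUC integral_setU//.
- rewrite [X in (_ + X)%E](_ : _ = 0%E) ?adde0//.
  apply: null_set_integral => //; first exact: measurable_funTS.
  by apply/eqP; rewrite eq_le measure_ge0 andbT -g0 le_measure ?inE//; exact: subIsetr.
- exact: measurable_funTS.
- by apply/disj_setPS => p [[_ h] [_ /h]].
Qed.

Lemma integral_cube_split k m f (c : idx -> R) : measurable_fun setT f ->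
  (forall e, \int[mu]_(p in cube (k - 1) (child m e)) (f p)%:E = (c e * vol (k - 1))%:E)%E ->
  (\int[mu]_(p in cube k m) (f p)%:E = (rt R n ^+ 2 * (\sum_e c e)%R * vol k)%:E)%E.
Proof.
move=> mf h; rewrite cubeU integral_bigsetU_EFin//=; last 4 first.
- by move=> e; exact: measurable_cube.
- exact: enum_uniq.
- exact: trivIset_cube.
- by apply/measurable_EFinP; exact: measurable_funTS.
rewrite big_enum/=; under eq_bigr do rewrite h.
by rewrite sumEFin -mulr_suml vol_half mulrCA mulrA.
Qed.

Lemma integral_cube_cst k m (c : R) :
  (\int[mu]_(p in cube k m) c%:E = (c * vol k)%:E)%E.
Proof.
by rewrite (integral_cst mu (@measurable_cube R n k m)) EFinM -(measure_cube k m).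
Qed.

Lemma integrable_cube_cst k m (c : R) : mu.-integrable (cube k m) (cst c%:E).
Proof.
apply/integrableP; split; first exact: measurable_cst.
by rewrite (integral_cube_cst k m `|c|) ltry.
Qed.

(** Passes from averages over open cubes to integrals off the grid, where a cube is exactly the
    disjoint union of its children. *)
Lemma avg_integral k m g (r : R) : measurable_fun setT g ->
  avg (dcube k m) g = r%:E <->
  (\int[mu]_(p in cube k m) g p = (r * vol k)%:E)%E.
Proof.
move=> mg; rewrite /avg integral_cubeE// measure_dyadic -/(vol k).
have v0 := vol_gt0 k; rewrite inver gt_eqF//.
split=> [h|->]; last first.
  by rewrite -EFinM mulrCA mulVf ?mulr1// gt_eqF.
case: (\int[_]_(_ in _) _)%E h => [s||].
- by rewrite -EFinM => -[<-]; congr EFin; field; rewrite gt_eqF.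
- by rewrite gt0_muley// lte_fin invr_gt0.
- by rewrite gt0_muleNy// lte_fin invr_gt0.
Qed.

Lemma measurable_half k m (F : idx -> Rn R n -> R) :
  (forall e, measurable_fun setT (F e)) ->
  measurable_fun setT (fun p => F (half_of k m p) p).
Proof.
move=> mF _ B mB; rewrite setTI.
rewrite (_ : _ @^-1` B = \big[setU/set0]_(e <- enum idx)
    ([set p | half_of k m p = e] `&` F e @^-1` B)); last first.
  rewrite -bigcup_seq; apply/seteqP; split => [p h|p [e _ [<-]]//].
  by exists (half_of k m p) => //; rewrite /= mem_enum.
apply: bigsetU_measurable => e _; apply: measurableI; last first.
  by rewrite -[X in measurable X]setTI; exact: mF.
rewrite (_ : [set p | _] = \big[setI/setT]_(i < n)
    ((fun t : Rn R n => tnth t i) @^-1`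
      [set x | (dy R (k - 1) (2 * m i + 1) < x) = e i])).
  apply: bigsetI_measurable => i _; rewrite -[X in measurable X]setTI.
  apply: measurable_tnth => //; case: (e i).
    rewrite (_ : [set x | _] = `]dy R (k - 1) (2 * m i + 1), +oo[%classic)//.
    by apply/seteqP; split => x; rewrite /= in_itv/= andbT.
  rewrite (_ : [set x | _] = `]-oo, dy R (k - 1) (2 * m i + 1)]%classic)//.
  by apply/seteqP; split => x; rewrite /= in_itv/= leNgt; [move=> ->|move/negbTE].
rewrite -bigcap_seq; apply/seteqP; split => [p <- i _|p h]; first by rewrite /= ffunE.
by apply/ffunP => i; rewrite ffunE; apply: h; rewrite /= mem_index_enum.
Qed.

Fixpoint step t k m p : R :=
  match t with
  | Leaf q => q.1
  | Node s => step (s (half_of k m p)) (k - 1) (child m (half_of k m p)) p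
  end.

Fixpoint smax t L k m p : R :=
  match t with
  | Leaf q => Num.max L q.1
  | Node s => smax (s (half_of k m p)) (Num.max L (pt (Node s)).1) (k - 1)
                (child m (half_of k m p)) p
  end.

Lemma measurable_step t k m : measurable_fun setT (step t k m).
Proof.
elim: t k m => [q|s IH] k m /=; first exact: measurable_cst.
by apply: (@measurable_half k m (fun e => step (s e) (k - 1) (child m e))) => e.
Qed.

Lemma measurable_smax t L k m : measurable_fun setT (smax t L k m).
Proof.
elim: t L k m => [q|s IH] L k m /=; first exact: measurable_cst.
by apply: (@measurable_half k m (fun e => smax (s e) _ (k - 1) (child m e))) => e.
Qed.

(** The constant [c] is separate from [L] because the level rises during the induction while the
    subtracted constant stays; the lemma is applied with [c = L]. *)
Lemma integral_smaxB t L c k m :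
  (\int[mu]_(p in cube k m) (smax t L k m p - c)%:E =
   ((tree_val L t - c) * vol k)%:E)%E.
Proof.
elim: t L k m => [q|s IH] L k m; first exact: (integral_cube_cst k m (Num.max L q.1 - c)).
rewrite (@integral_cube_split k m (fun p => smax (Node s) L k m p - c)
  (fun e => tree_val (Num.max L (pt (Node s)).1) (s e) - c)).
- by rewrite sumrB mulrBr mean_const.
- by apply: measurable_funB; [exact: measurable_smax|exact: measurable_cst].
move=> e; rewrite -(IH e _ _ (child m e)); apply: eq_integral => p.
rewrite inE => /cube_child[_ he].
by rewrite [smax (Node s) _ _ _ _]/= he.
Qed.

Lemma integral_step t k m :
  (\int[mu]_(p in cube k m) (step t k m p)%:E = ((pt t).1 * vol k)%:E)%E.
Proof.
elim: t k m => [q|s IH] k m; first exact: integral_cube_cst.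
rewrite (@integral_cube_split k m _ (fun e => (pt (s e)).1))//.
  exact: measurable_step.
move=> e; rewrite -(IH e _ (child m e)); apply: eq_integral => p.
rewrite inE => /cube_child[_ he].
by rewrite [step (Node s) _ _ _]/= he.
Qed.

Lemma integral_step2 t k m : flat t ->
  (\int[mu]_(p in cube k m) (step t k m p ^+ 2)%:E = ((pt t).2 * vol k)%:E)%E.
Proof.
elim: t k m => [q|s IH] k m ft; first by move: ft => /= ->; exact: integral_cube_cst.
rewrite (@integral_cube_split k m (fun p => step (Node s) k m p ^+ 2)
  (fun e => (pt (s e)).2))//.
  by apply: measurable_funX; exact: measurable_step.
move=> e; rewrite -(IH e _ (child m e))//; apply: eq_integral => p.
rewrite inE => /cube_child[_ he].
by rewrite [step (Node s) _ _ _]/= he.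
Qed.

Lemma cube_neq0 k m : cube k m !=set0.
Proof.
apply/set0P/eqP => C0; have := measure_cube k m; rewrite C0 measure0 => -[] /esym/eqP.
by rewrite gt_eqF// vol_gt0.
Qed.

Lemma dyadic_le k k' m m' : dcube k' m' `<=` dcube k m -> (k' <= k)%R.
Proof using n_ge1.
move=> h; have : (mu (dcube k' m') <= mu (dcube k m))%E.
  by apply: le_measure; rewrite ?inE//; exact: measurable_dyadic.
rewrite !measure_dyadic lee_fin ler_pXn2r ?nnegrE ?(ltW (two_gt0 _ _))//.
by rewrite ler_eXz2l// ltr1n.
Qed.

Lemma int_le_ex (k k' : int) : (k' <= k)%R -> exists d : nat, k = k' + d%:Z.
Proof. by move=> h; exists `|k - k'|%N; rewrite gez0_abs ?subr_ge0//; ring. Qed.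

Lemma dyadic_sub_cases k k' m m' : dcube k' m' `<=` dcube k m ->
  dcube k' m' = dcube k m \/ exists e, dcube k' m' `<=` dcube (k - 1) (child m e).
Proof using n_ge1.
move=> h; have kk' := dyadic_le h; have [p pC'] := cube_neq0 k' m'.
have pD' : dcube k' m' p by case: pC'.
have pD := h _ pD'; have pC : cube k m p by split => //; case: pC'.
have [/eqP E|kk'0] := boolP (k' == k).
  left; apply/seteqP; split => //; subst k'.
  have := @dyadic_nested R n k 0 m' m p; rewrite addr0; exact.
have [d dE] : exists d : nat, k - 1 = k' + d%:Z.
  by apply: int_le_ex; rewrite -ltzD1 subrK lt_neqAle kk'0.
right; exists (half_of k m p); have := half_ofP pC; rewrite dE => hp.
exact: dyadic_nested hp pD'.
Qed.

Lemma dyadic_dich k k' m m' p : dcube k m p -> dcube k' m' p ->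
  dcube k m `<=` dcube k' m' \/ dcube k' m' `<=` dcube k m.
Proof.
move=> hp hp'; have [/int_le_ex[d E]|/ltW/int_le_ex[d E]] := leP k' k; subst.
  by right; exact: dyadic_nested hp hp'.
by left; exact: dyadic_nested hp' hp.
Qed.
End steps.

(** * The dyadic maximal function *)

Section maximal.
Variables (R : realType) (n : nat).
Hypothesis n_ge1 : (1 <= n)%N.
Local Notation idx := {ffun 'I_n -> bool}.
Local Notation mu := (@lebesgue_measure_n R n).
Local Notation dcube := (@dyadic_cube R n).
Local Notation cube := (@cube R n).
Local Notation half_of := (@half_of R n).
Local Notation vol := (@vol R n).
Local Notation rt := (@rt R n).
Local Notation om x := (0 <= vari x <= 1).
Implicit Types (k : int) (m : 'I_n -> int) (p : Rn R n) (e : idx) (t : tree R n).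
Implicit Types (phi : Rn R n -> R).

Lemma measurable_maximal phi : measurable_fun setT (dyadic_maximal phi).
Proof.
apply: (measurability (@ErealGenOInfty.G R)).
  exact: ErealGenOInfty.measurableE.
move=> _ [_ [r ->] <-]; rewrite setTI.
(* Superlevel sets are unions of dyadic cubes. Finite functions as positions make the index type
   countable. *)
pose c (u : int * {ffun 'I_n -> int}) : set (Rn R n) :=
  if (r%:E < avg (dcube u.1 u.2) (EFin \o phi))%E then dcube u.1 u.2 else set0.
rewrite (_ : _ @^-1` _ = \bigcup_u c u); last first.
  apply/seteqP; split => [p|p [u _]].
    rewrite /= in_itv/= andbT => /ereal_sup_gt[_ [J [[k [m JE]] Jp] <-] lt].
    have mE : (finfun m : 'I_n -> int) = m by apply/funext => i; rewrite ffunE.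
    by exists (k, finfun m) => //; rewrite /c/= mE -JE lt.
  rewrite /c; case: ifPn => // lt up; rewrite /= in_itv/= andbT.
  apply: lt_le_trans lt _; apply: ereal_sup_ubound; exists (dcube u.1 u.2) => //.
  by split => //; exists u.1, u.2.
pose f (q : nat) := if unpickle q is Some u then c u else set0.
rewrite (_ : \bigcup_u c u = \bigcup_q f q); last first.
  apply/seteqP; split => [p [u _ h]|p [q _]].
    by exists (pickle u); rewrite // /f pickleK.
  by rewrite /f; case: unpickle => // u h; exists u.
apply: bigcupT_measurable => q; rewrite /f; case: unpickle => // u.
by rewrite /c; case: ifP => // _; exact: measurable_dyadic.
Qed.

Lemma smax_ge t L k m p : L <= smax t L k m p.
Proof.
elim: t L k m => [q|s IH] L k m /=; first by rewrite le_max lexx.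
by apply: le_trans (IH _ _ _ _); rewrite le_max lexx.
Qed.

(** The maximal function has no sign. The finite integral of the nonnegative [N phi - L] makes this
    difference integrable, and [L] can then be added back. *)
Lemma avg_maximal phi k m (L r : R) :
  (forall p, cube k m p -> (L%:E <= dyadic_maximal phi p)%E) ->
  (\int[mu]_(p in cube k m) (dyadic_maximal phi p - L%:E) = (r * vol k)%:E)%E ->
  avg (dcube k m) (dyadic_maximal phi) = (L + r)%:E.
Proof.
move=> NL NE; have mN := @measurable_maximal phi.
have mC := @measurable_cube R n k m.
apply/avg_integral => //.
have mNL : measurable_fun (cube k m) (fun p => dyadic_maximal phi p - L%:E)%E.
  apply: emeasurable_funB; last exact: measurable_cst.
  exact: measurable_funTS.
have iN : mu.-integrable (cube k m) (fun p => dyadic_maximal phi p - L%:E)%E.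
  apply/integrableP; split => //.
  under eq_integral => p; first rewrite inE => pC.
    rewrite gee0_abs ?sube_ge0 ?NL//.
    over.
  by rewrite NE ltry.
have iL : mu.-integrable (cube k m) (cst L%:E).
  exact: integrable_cube_cst.
transitivity (\int[mu]_(p in cube k m) ((dyadic_maximal phi p - L%:E) + L%:E))%E.
  by apply: eq_integral => p _; rewrite subeK.
by rewrite integralD// NE integral_cube_cst -EFinD mulrDl addrC.
Qed.

(** * Upper bound through truncated trees of averages *)

Section above.
Variables (k0 : int) (m0 : 'I_n -> int) (phi : Rn R n -> R).
Variables (P : int -> ('I_n -> int) -> R * R) (L b : R).
Hypothesis P1 : forall k m, dcube k m `<=` dcube k0 m0 ->
  avg (dcube k m) (EFin \o phi) = (P k m).1%:E.
Hypothesis P_om : forall k m, dcube k m `<=` dcube k0 m0 -> om (P k m).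
Hypothesis P_mean : forall k m, dcube k m `<=` dcube k0 m0 ->
  P k m = pt (Node (fun e => Leaf n (P (k - 1) (child m e)))).
Hypothesis P_L : forall J, dyadic J -> dcube k0 m0 `<=` J ->
  (avg J (EFin \o phi) <= L%:E)%E.
Hypothesis L_P : forall p, dcube k0 m0 p -> (L%:E <= dyadic_maximal phi p)%E.
Hypothesis bP : bval rt (Tshift L (P k0 m0)) b.

Fixpoint mean_tree (j : nat) k m : tree R n :=
  if j is j'.+1 then Node (fun e => mean_tree j' (k - 1) (child m e))
  else Leaf n (P k m).

Let sub_child k m e : dcube k m `<=` dcube k0 m0 ->
  dcube (k - 1) (child m e) `<=` dcube k0 m0.
Proof. by move=> h; apply: subset_trans h; exact: child_sub. Qed.

Lemma pt_mean_tree j k m : dcube k m `<=` dcube k0 m0 ->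
  pt (mean_tree j k m) = P k m.
Proof using P_mean.
elim: j k m => // j IH k m h; rewrite (P_mean h) /=.
by congr pair; congr (_ * _); apply: eq_bigr => e _; rewrite IH//; exact: sub_child.
Qed.

Lemma valid_mean_tree j k m : dcube k m `<=` dcube k0 m0 -> valid (mean_tree j k m).
Proof using P_mean P_om.
elim: j k m => [|j IH] k m h; first exact: P_om.
split; first by rewrite -[Node _]/(mean_tree j.+1 k m) pt_mean_tree//; exact: P_om.
by move=> e; apply: IH; exact: sub_child.
Qed.

Lemma smax_mean_treeS j c k m p : dcube k m `<=` dcube k0 m0 ->
  smax (mean_tree j k m) c k m p <= smax (mean_tree j.+1 k m) c k m p.
Proof using P_mean.
elim: j c k m => [|j IH] c k m h.
  rewrite -[leRHS]/(smax (Leaf n (P (k - 1) (child m (half_of k m p))))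
    (Num.max c (pt (mean_tree 1 k m)).1) (k - 1) (child m (half_of k m p)) p).
  by rewrite pt_mean_tree// /= le_max lexx.
have ptE i := @pt_mean_tree i.+1 k m h.
rewrite -[leLHS]/(smax (mean_tree j (k - 1) (child m (half_of k m p)))
    (Num.max c (pt (mean_tree j.+1 k m)).1) (k - 1) (child m (half_of k m p)) p).
rewrite -[leRHS]/(smax (mean_tree j.+1 (k - 1) (child m (half_of k m p)))
    (Num.max c (pt (mean_tree j.+2 k m)).1) (k - 1) (child m (half_of k m p)) p).
by rewrite !ptE; apply: IH; exact: sub_child.
Qed.

Lemma avg_le_smax (d : nat) c k m m' p : dcube (k + d%:Z) m `<=` dcube k0 m0 ->
  dcube k m' `<=` dcube (k + d%:Z) m -> cube k m' p ->
  (avg (dcube k m') (EFin \o phi) <=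
   (smax (mean_tree d (k + d%:Z) m) c (k + d%:Z) m p)%:E)%E.
Proof using P_mean P1 n_ge1.
elim: d c m => [|d IH] c m h hm hp.
  rewrite addr0 in h hm *; have -> : dcube k m' = dcube k m.
    apply/seteqP; split => //; have [q [qm' _]] := cube_neq0 R k m'.
    by have := @dyadic_nested R n k 0 m' m q; rewrite addr0; apply => //; exact: hm.
  by rewrite P1// lee_fin /= le_max lexx orbT.
have kE : k + d.+1%:Z - 1 = k + d%:Z by rewrite -addn1 PoszD addrA addrK.
have pm : cube (k + d.+1%:Z) m p by case: hp => hp gp; split => //; exact: hm.
set e := half_of (k + d.+1%:Z) m p.
have he : dcube (k + d%:Z) (child m e) p by rewrite -kE; exact: half_ofP.
rewrite -[smax _ _ _ _ _]/(smax (mean_tree d (k + d.+1%:Z - 1) (child m e))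
   (Num.max c (pt (mean_tree d.+1 (k + d.+1%:Z) m)).1) (k + d.+1%:Z - 1) (child m e) p).
rewrite kE; apply: IH => //.
  by rewrite -kE; exact: sub_child.
by apply: dyadic_nested he _; case: hp.
Qed.

Lemma integral_maximal_le :
  (\int[mu]_(p in cube k0 m0) (dyadic_maximal phi p - L%:E) <= (b * vol k0)%:E)%E.
Proof using All.
have mC := @measurable_cube R n k0 m0; have mN := @measurable_maximal phi.
pose h (j : nat) p : \bar R := (smax (mean_tree j k0 m0) L k0 m0 p - L)%:E.
have mh j : measurable_fun (cube k0 m0) (h j).
  apply/measurable_EFinP; apply: measurable_funB; last exact: measurable_cst.
  exact: measurable_funTS (measurable_smax _ _ _ _).
have h0 j p : (0 <= h j p)%E by rewrite lee_fin subr_ge0 smax_ge.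
have hS p : {homo h^~ p : i j / (i <= j)%N >-> (i <= j)%E}.
  apply/nondecreasing_seqP => j; rewrite lee_fin lerD2r.
  exact: smax_mean_treeS.
have hlim p : limn (h^~ p) = ereal_sup (range (h^~ p)).
  by apply/cvg_lim => //; exact: ereal_nondecreasing_cvgn.
apply: (@le_trans _ _ (\int[mu]_(p in cube k0 m0) limn (h^~ p))%E).
  apply: ge0_le_integral => //.
  - by move=> p [pC _]; rewrite sube_ge0 ?L_P.
  - apply: emeasurable_funB; last exact: measurable_cst.
    exact: measurable_funTS.
  - apply: (emeasurable_fun_cvg h) => // p _.
    by rewrite hlim; apply: ereal_nondecreasing_cvgn; exact: hS.
  - move=> p pC; have [pD pg] := pC; rewrite hlim leeBlDr//.
    apply: ge_ereal_sup => _ [J [[k [m ->]] Jp] <-].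
    (* A dyadic cube through [p] either contains the root cube, and its average is at most [L], or
       is a leaf of the tree of [d] generations. *)
    have [QJ|JQ] := dyadic_dich pD Jp.
      apply: (@le_trans _ _ L%:E); first by apply: P_L => //; exists k, m.
      by rewrite leeDr// (le_trans (h0 0%N p))//; apply: ereal_sup_ubound; exists 0%N.
    have [d dE] := int_le_ex (dyadic_le n_ge1 JQ).
    rewrite -leeBlDr//; apply: (@le_trans _ _ (h d p)); last first.
      by apply: ereal_sup_ubound; exists d.
    rewrite /h EFinB leeB//.
    have := @avg_le_smax d L k m0 m p; rewrite -dE; apply => //.
rewrite monotone_convergence//.
apply: lime_le.
  apply: ereal_nondecreasing_is_cvgn => i j ij; apply: ge0_le_integral => //.
  by move=> p _; exact: hS.
apply: nearW => j; rewrite /h.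
rewrite integral_smaxB lee_fin ler_pM2r ?vol_gt0//.
rewrite lerBlDl; apply: tree_val_le => //; first exact: valid_mean_tree.
by rewrite pt_mean_tree.
Qed.
End above.
End maximal.

(** * Functions of the Bellman class *)

Section class_upper.
Variables (R : realType) (n : nat).
Hypothesis n_ge1 : (1 <= n)%N.
Local Notation mu := (@lebesgue_measure_n R n).
Local Notation dcube := (@dyadic_cube R n).
Local Notation cube := (@cube R n).
Local Notation vol := (@vol R n).
Local Notation rt := (@rt R n).
Local Notation om x := (0 <= vari x <= 1).
Implicit Types (k : int) (m : 'I_n -> int).
Variables (k0 : int) (m0 : 'I_n -> int) (x : R * R) (L : R) (phi : Rn R n -> R).
Hypothesis phiE : bellman_class x L (dcube k0 m0) phi.

Let mphi : measurable_fun setT phi.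
Proof. by case: (bellman_loc phiE). Qed.

Let mphi2 : measurable_fun setT (fun p => phi p ^+ 2).
Proof. exact: measurable_funX. Qed.

Lemma class_integrable k m : dcube k m `<=` dcube k0 m0 ->
  mu.-integrable (dcube k m) (EFin \o phi).
Proof using phiE.
move=> h; have mD := @measurable_dyadic R n k m.
apply/integrableP; split; first by apply/measurable_EFinP; exact: measurable_funTS.
have [_ /(_ [tuple dy R k (m i) | i < n] [tuple dy R k (m i + 1) | i < n])] :=
  bellman_loc phiE.
apply: le_lt_trans; set B := [set t | _].
have mB : measurable B.
  rewrite (_ : B = \big[setI/setT]_(i < n)
      ((fun t : Rn R n => tnth t i) @^-1` `[dy R k (m i), dy R k (m i + 1)]%classic)).
    apply: bigsetI_measurable => i _; rewrite -[X in measurable X]setTI.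
    exact: measurable_tnth.
  rewrite -bigcap_seq; apply/seteqP; split => t /= ht i.
    by move=> _; have := ht i; rewrite !tnth_mktuple /= in_itv.
  by have := ht i; rewrite /= mem_index_enum in_itv !tnth_mktuple; exact.
apply: ge0_subset_integral => //.
  by apply/measurable_EFinP/measurableT_comp => //; exact: measurable_funTS.
move=> t ht i; rewrite !tnth_mktuple; have /andP[h1 h2] := ht i.
by rewrite /dy !ltW.
Qed.

Lemma class_integrable2 k m : dcube k m `<=` dcube k0 m0 ->
  mu.-integrable (dcube k m) (fun p => (phi p ^+ 2)%:E).
Proof using phiE.
move=> h; have mD := @measurable_dyadic R n k m.
have mQ := @measurable_dyadic R n k0 m0.
apply: (@integrableS _ _ _ _ (dcube k0 m0)) => //.
have mp : measurable_fun setT (fun p => (phi p ^+ 2)%:E) by exact/measurable_EFinP.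
apply/integrableP; split; first exact: measurable_funTS.
under eq_integral do rewrite gee0_abs ?lee_fin ?sqr_ge0//.
rewrite integral_cubeE//.
by have /avg_integral -> := bellman_avg2 phiE; rewrite ?ltry.
Qed.

(** On subcubes of the root cube [fine] loses nothing, as both averages are finite there by
    [class_avg] and [class_avg2]. *)
Definition class_pt k m : R * R :=
  (fine (avg (dcube k m) (EFin \o phi)), fine (avg (dcube k m) (fun p => (phi p ^+ 2)%:E))).

Let avg_fin k m (g : Rn R n -> \bar R) : mu.-integrable (dcube k m) g ->
  avg (dcube k m) g = (fine (avg (dcube k m) g))%:E.
Proof.
move=> ig; rewrite fineK// /avg measure_dyadic inver gt_eqF ?vol_gt0// fin_numM//.
by apply: integrable_fin_num => //; exact: measurable_dyadic.
Qed.

Lemma class_avg k m : dcube k m `<=` dcube k0 m0 ->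
  avg (dcube k m) (EFin \o phi) = (class_pt k m).1%:E.
Proof using phiE. by move=> h; apply: avg_fin; exact: class_integrable. Qed.

Lemma class_avg2 k m : dcube k m `<=` dcube k0 m0 ->
  avg (dcube k m) (fun p => (phi p ^+ 2)%:E) = (class_pt k m).2%:E.
Proof using phiE. by move=> h; apply: avg_fin; exact: class_integrable2. Qed.

Let mEphi : measurable_fun setT (EFin \o phi).
Proof. exact/measurable_EFinP. Qed.

Let mEphi2 : measurable_fun setT (fun p => (phi p ^+ 2)%:E).
Proof. exact/measurable_EFinP. Qed.

Lemma class_om k m : dcube k m `<=` dcube k0 m0 -> om (class_pt k m).
Proof using phiE.
move=> h; have a1 := class_avg h; have a2 := class_avg2 h.
have mC := @measurable_cube R n k m; have mD := @measurable_dyadic R n k m.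
set c := (class_pt k m).1 in a1 *; set d := (class_pt k m).2 in a2 *.
apply/andP; split; last first.
  have := bellman_norm phiE => h1.
  have : (sqrte (avg (dcube k m) (fun p => (phi p ^+ 2)%:E) -
       avg (dcube k m) (EFin \o phi) ^+ 2) <= 1)%E.
    apply: le_trans h1; apply: ereal_sup_ubound; exists (dcube k m) => //.
    by split => //; exists k, m.
  rewrite a1 a2 -EFin_expe -EFinB /= lee_fin -/(vari (class_pt k m)).
  (* The square root of a negative number is 0, so the norm says something only for a nonnegative
     variance; a negative one is below 1 anyway. *)
  move=> s1; rewrite /vari -/c -/d; have [v0|v0] := leP 0 (d - c ^+ 2); last by lra.
  by rewrite -(sqr_sqrtr v0) exprn_ile1// sqrtr_ge0.
have i1 : mu.-integrable (cube k m) (EFin \o phi).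
  by apply: (integrableS mD mC (@cube_sub R n k m)); exact: class_integrable.
have i2 : mu.-integrable (cube k m) (fun p => (phi p ^+ 2)%:E).
  by apply: (integrableS mD mC (@cube_sub R n k m)); exact: class_integrable2.
have /avg_integral e1 := a1; have /avg_integral e2 := a2.
(* Nonnegativity of the variance: [2 c phi <= phi ^ 2 + c ^ 2] is integrated with [c] the mean of
   [phi]. *)
have : (\int[mu]_(p in cube k m) ((2 * c)%:E * (phi p)%:E) <=
        \int[mu]_(p in cube k m) ((phi p ^+ 2)%:E + (c ^+ 2)%:E))%E.
  apply: le_integral => //.
  - exact: integrableZl.
  - by apply: integrableD => //; exact: integrable_cube_cst.
  - move=> p _; rewrite -EFinM -EFinD lee_fin.
    by have := sqr_ge0 (phi p - c); nra.
rewrite integralZl// integralD//; last exact: integrable_cube_cst.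
rewrite e1// e2// integral_cube_cst -EFinM -EFinD lee_fin mulrA -mulrDl.
by rewrite ler_pM2r ?vol_gt0// /vari -/c -/d; lra.
Qed.

Lemma class_mean k m : dcube k m `<=` dcube k0 m0 ->
  class_pt k m = pt (Node (fun e => Leaf n (class_pt (k - 1) (child m e)))).
Proof using phiE.
move=> h; have hs e : dcube (k - 1) (child m e) `<=` dcube k0 m0.
  by apply: subset_trans h; exact: child_sub.
have v0 := vol_gt0 R n k.
rewrite [LHS]surjective_pairing /=; congr pair; apply: (mulIf (lt0r_neq0 v0)).
- have /avg_integral h1 := class_avg h.
  apply: EFin_inj; rewrite -h1//.
  rewrite (@integral_cube_split _ _ k m phi (fun e => (class_pt (k - 1) (child m e)).1))//.
  by move=> e; have /avg_integral h2 := class_avg (hs e); exact: h2.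
- have /avg_integral h1 := class_avg2 h.
  apply: EFin_inj; rewrite -h1//.
  rewrite (@integral_cube_split _ _ k m (fun p => phi p ^+ 2)
    (fun e => (class_pt (k - 1) (child m e)).2))//.
  by move=> e; have /avg_integral h2 := class_avg2 (hs e); exact: h2.
Qed.

Lemma class_maximal_ge p : dcube k0 m0 p -> (L%:E <= dyadic_maximal phi p)%E.
Proof using phiE.
move=> hp; rewrite -(bellman_sup phiE); apply: le_ereal_sup => _ [J [dJ QJ] <-].
by exists J => //; split => //; exact: QJ.
Qed.

Lemma class_ptE : class_pt k0 m0 = x.
Proof using phiE.
rewrite [RHS]surjective_pairing /class_pt.
by rewrite (bellman_avg phiE) (bellman_avg2 phiE).
Qed.

(** The form with a real [r] records that the integral is finite, as [avg_maximal] requires. *)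
Lemma class_upper b : bval rt (Tshift L x) b ->
  exists2 r, 0 <= r <= b &
    (\int[mu]_(p in cube k0 m0) (dyadic_maximal phi p - L%:E) = (r * vol k0)%:E)%E.
Proof using n_ge1 phiE.
move=> bx; have v0 := vol_gt0 R n k0.
have : (\int[mu]_(p in cube k0 m0) (dyadic_maximal phi p - L%:E) <=
        (b * vol k0)%:E)%E.
  apply: (@integral_maximal_le _ _ n_ge1 k0 m0 phi class_pt) => //.
  - exact: class_avg.
  - exact: class_om.
  - exact: class_mean.
  - move=> J dJ QJ; rewrite -(bellman_sup phiE); apply: ereal_sup_ubound.
    by exists J.
  - exact: class_maximal_ge.
  - by rewrite class_ptE.
have : (0 <= \int[mu]_(p in cube k0 m0) (dyadic_maximal phi p - L%:E))%E.
  by apply: integral_ge0 => p [hp _]; rewrite sube_ge0 ?class_maximal_ge.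
case: (\int[_]_(_ in _) _)%E => // s s0 sb; rewrite !lee_fin in s0 sb.
exists (s / vol k0); last by rewrite divfK// gt_eqF.
by rewrite divr_ge0 ?(ltW v0)//= ler_pdivrMr.
Qed.
End class_upper.

(** * Extremal functions *)

Section class_lower.
Variables (R : realType) (n : nat).
Hypothesis n_ge1 : (1 <= n)%N.
Local Notation idx := {ffun 'I_n -> bool}.
Local Notation mu := (@lebesgue_measure_n R n).
Local Notation dcube := (@dyadic_cube R n).
Local Notation cube := (@cube R n).
Local Notation half_of := (@half_of R n).
Local Notation vol := (@vol R n).
Local Notation rt := (@rt R n).
Local Notation om x := (0 <= vari x <= 1).
Implicit Types (k : int) (m : 'I_n -> int) (p : Rn R n) (t : tree R n).

Lemma step_bounded t : exists C, forall k m p, `|step t k m p| <= C.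
Proof.
elim: t => [q|s IH]; first by exists `|q.1|.
have [C hC] := choice IH; exists (\sum_e C e) => k m p.
have C0 e : 0 <= C e by apply: le_trans (hC e 0 (fun=> 0) p).
rewrite [step _ _ _ _]/= (bigD1 (half_of k m p))//=.
by apply: le_trans (hC _ _ _ _) _; rewrite lerDl sumr_ge0.
Qed.

(** A dyadic subcube either is the cube of a node, where validity of the tree gives the claim, or
    lies in the cube of a leaf, where the function is constant and [flat] identifies the second
    moment. *)
Lemma step_pt t k m k' m' : valid t -> flat t -> dcube k' m' `<=` dcube k m ->
  exists q, [/\ om q,
    (\int[mu]_(p in cube k' m') (step t k m p)%:E = (q.1 * vol k')%:E)%E &
    (\int[mu]_(p in cube k' m') (step t k m p ^+ 2)%:E = (q.2 * vol k')%:E)%E].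
Proof using n_ge1.
elim: t k m => [q|s IH] k m vt ft h.
  exists q; split => //; first exact: (integral_cube_cst k' m' q.1).
  by move: ft => /= ->; exact: (integral_cube_cst k' m' (q.1 ^+ 2)).
have [E|[e he]] := dyadic_sub_cases n_ge1 h.
  have vE : vol k' = vol k.
    by apply: EFin_inj; rewrite -(measure_dyadic R k m) -(measure_dyadic R k' m') E.
  exists (pt (Node s)); split; first exact: valid_om.
    by rewrite /cube E vE; exact: integral_step.
  by rewrite /cube E vE; exact: integral_step2.
have [q [q1 q2 q3]] := IH e _ (child m e) (vt.2 e) (ft e) he.
have hstep p : cube k' m' p -> step (Node s) k m p = step (s e) (k - 1) (child m e) p.
  move=> [hp gp]; have /cube_child[_ E] : cube (k - 1) (child m e) p.
    by split => //; exact: he.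
  by rewrite [LHS]/= E.
exists q; split => //.
  by rewrite -q2; apply: eq_integral => p; rewrite inE => /hstep ->.
by rewrite -q3; apply: eq_integral => p; rewrite inE => /hstep ->.
Qed.

Lemma parent_cube (d : nat) k m : exists m', dcube k m `<=` dcube (k + d%:Z) m'.
Proof.
elim: d => [|d [m' h]]; first by exists m; rewrite addr0.
(* Division by 2 rounds down for negative positions too, so the remainder is always the side of the
   child. *)
pose m1 : 'I_n -> int := fun i => (m' i %/ 2)%Z.
pose e : idx := [ffun i => (m' i %% 2)%Z != 0].
have mE : m' = child m1 e.
  apply/funext => i; rewrite /child ffunE {1}(divz_eq (m' i) 2) mulrC; congr (_ + _).
  have : (0 <= (m' i %% 2)%Z < 2) by rewrite modz_ge0// ltz_pmod.
  by case: (m' i %% 2)%Z => [[|[|]]|].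
exists m1; apply: subset_trans h _.
have -> : k + d%:Z = k + d.+1%:Z - 1 by rewrite -[d.+1]addn1 PoszD addrA addrK.
by rewrite mE; exact: child_sub.
Qed.

Lemma smax_le_maximal t k m (phi : Rn R n -> R) (L : R) p :
  measurable_fun setT phi ->
  (forall q, dcube k m q -> phi q = step t k m q) -> cube k m p ->
  (L%:E <= dyadic_maximal phi p)%E ->
  ((smax t L k m p)%:E <= dyadic_maximal phi p)%E.
Proof.
move=> mphi; have mE : measurable_fun setT (EFin \o phi) by exact/measurable_EFinP.
have node t' k' m' : (forall q, dcube k' m' q -> phi q = step t' k' m' q) ->
    cube k' m' p -> ((pt t').1%:E <= dyadic_maximal phi p)%E.
  move=> hphi [pD pg]; apply: ereal_sup_ubound; exists (dcube k' m').
    by split => //; exists k', m'.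
  apply/avg_integral => //; rewrite -(integral_step t' k' m'); apply: eq_integral => q.
  by rewrite inE => -[/hphi qE _]; rewrite /= qE.
have maxE (u v : R) : (u%:E <= dyadic_maximal phi p)%E ->
    (v%:E <= dyadic_maximal phi p)%E -> ((Num.max u v)%:E <= dyadic_maximal phi p)%E.
  by rewrite /Num.max; case: ifP.
elim: t k m L => [q|s IH] k m L hphi hp hL.
  by apply: maxE => //; exact: node hphi hp.
rewrite [smax _ _ _ _ _]/=; apply: IH; first last.
- by apply: maxE => //; exact: node hphi hp.
- by apply/cube_child.
- move=> q hq; rewrite hphi; last exact: child_sub hq.
  by rewrite [LHS]/= (half_ofE hq).
Qed.

Section phi.
Variables (k0 : int) (m0 : 'I_n -> int) (t : tree R n) (L : R).
Hypotheses (vt : valid t) (ft : flat t) (tL : (pt t).1 <= L).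

Definition tree_phi p : R := if `[< dcube k0 m0 p >] then step t k0 m0 p else L.

Lemma tree_phiE p : dcube k0 m0 p -> tree_phi p = step t k0 m0 p.
Proof. by move=> h; rewrite /tree_phi; case: asboolP. Qed.

Lemma tree_phiC p : ~ dcube k0 m0 p -> tree_phi p = L.
Proof. by move=> h; rewrite /tree_phi; case: asboolP. Qed.

Lemma measurable_tree_phi : measurable_fun setT tree_phi.
Proof.
have mD := @measurable_dyadic R n k0 m0.
move=> _ B mB; rewrite setTI (_ : _ @^-1` B =
   (dcube k0 m0 `&` step t k0 m0 @^-1` B) `|` (~` dcube k0 m0 `&` (cst L @^-1` B))).
  apply: measurableU; apply: measurableI; [exact: mD| |exact: measurableC|].
    by rewrite -[X in measurable X]setTI; exact: measurable_step.
  by rewrite -[X in measurable X]setTI; exact: measurable_cst.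
apply/seteqP; split => p /=.
  have [h|h] := pselect (dcube k0 m0 p); first by rewrite tree_phiE//; left.
  by rewrite tree_phiC//; right.
by move=> [[h]|[h]]; [rewrite tree_phiE|rewrite tree_phiC].
Qed.

Let mphi := measurable_tree_phi.

Let mEphi : measurable_fun setT (EFin \o tree_phi).
Proof. exact/measurable_EFinP. Qed.

Let mEphi2 : measurable_fun setT (fun p => (tree_phi p ^+ 2)%:E).
Proof. by apply/measurable_EFinP; exact: measurable_funX. Qed.

Lemma tree_phi_loc : locally_integrable_n tree_phi.
Proof.
split => // a b; set B := [set s | _]; have [C hC] := step_bounded t.
have phiC p : `|tree_phi p| <= Num.max C `|L|.
  rewrite le_max; have [h|h] := pselect (dcube k0 m0 p).
    by rewrite tree_phiE// hC.
  by rewrite tree_phiC// lexx orbT.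
have BE : B = [set s | forall i, `[tnth a i, tnth b i]%classic (tnth s i)].
  by apply/seteqP; split => s h i; have := h i; rewrite /= in_itv.
have mB : measurable B.
  rewrite (_ : B = \big[setI/setT]_(i < n)
      ((fun s : Rn R n => tnth s i) @^-1` `[tnth a i, tnth b i]%classic)).
    apply: bigsetI_measurable => i _; rewrite -[X in measurable X]setTI.
    exact: measurable_tnth.
  rewrite BE -bigcap_seq; apply/seteqP; split => s /= hs i.
    by move=> _; exact: hs.
  by apply: hs; rewrite /= mem_index_enum.
have Boo : (mu B < +oo)%E.
  rewrite BE (lebesgue_measure_n_box (A := fun i => `[tnth a i, tnth b i]%classic))//.
  rewrite (eq_bigr (fun i => (fine (lebesgue_measure `[tnth a i, tnth b i]%classic))%:E)).
    by rewrite prodEFin ltry.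
  move=> i _; rewrite fineK// lebesgue_measure_itv; case: ifP => // _.
apply: (@le_lt_trans _ _ (\int[mu]_(p in B) (cst (Num.max C `|L|)%:E) p)%E).
  apply: ge0_le_integral => //.
  - by apply/measurable_EFinP/measurableT_comp => //; exact: measurable_funTS.
  - by move=> p _; rewrite lee_fin.
rewrite integral_cst// lte_mul_pinfty// lee_fin le_max normr_ge0 orbT//.
Qed.

Lemma tree_phi_pt k m : dcube k m `<=` dcube k0 m0 -> exists q, [/\ om q,
  avg (dcube k m) (EFin \o tree_phi) = q.1%:E &
  avg (dcube k m) (fun p => (tree_phi p ^+ 2)%:E) = q.2%:E].
Proof using n_ge1 vt ft.
move=> h; have [q [q1 q2 q3]] := step_pt vt ft h; exists q; split => //.
  apply/avg_integral => //; rewrite -q2; apply: eq_integral => p.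
  by rewrite inE => -[hp _]; rewrite /= tree_phiE//; exact: h.
apply/avg_integral => //; rewrite -q3; apply: eq_integral => p.
by rewrite inE => -[hp _]; rewrite /= tree_phiE//; exact: h.
Qed.

Lemma tree_phi_bmo : (bmo_norm (dcube k0 m0) tree_phi <= 1)%E.
Proof using n_ge1 vt ft.
apply: ge_ereal_sup => _ [J [[k [m ->]] /tree_phi_pt[q [/andP[q0 q1] -> ->]]] <-].
rewrite -EFin_expe -EFinB /= lee_fin -/(vari q).
by rewrite -(@expr_le1 _ 2) ?sqrtr_ge0// sqr_sqrtr.
Qed.

Lemma tree_phi_avg : avg (dcube k0 m0) (EFin \o tree_phi) = (pt t).1%:E.
Proof.
apply/avg_integral => //; rewrite -(integral_step t k0 m0); apply: eq_integral => p.
by rewrite inE => -[hp _]; rewrite /= tree_phiE.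
Qed.

Lemma tree_phi_avg2 : avg (dcube k0 m0) (fun p => (tree_phi p ^+ 2)%:E) = (pt t).2%:E.
Proof using ft.
apply/avg_integral => //; rewrite -(integral_step2 k0 m0 ft); apply: eq_integral => p.
by rewrite inE => -[hp _]; rewrite /= tree_phiE.
Qed.

Lemma tree_phi_avg_above k m : dcube k0 m0 `<=` dcube k m ->
  avg (dcube k m) (EFin \o tree_phi) = (L - (L - (pt t).1) * (vol k0 / vol k))%:E.
Proof.
move=> h; apply/avg_integral => //.
have mC := @measurable_cube R n k m; have mC0 := @measurable_cube R n k0 m0.
have h' : cube k0 m0 `<=` cube k m by move=> p [hp gp]; split => //; exact: h.
rewrite -(setDUK h') integral_setU//; last 3 first.
- exact: measurableD.
- exact: measurable_funTS.
- by apply/disj_setPS => p [h1 [_ /(_ h1)]].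
have /avg_integral -> // := tree_phi_avg.
rewrite (eq_integral (cst L%:E)); last first.
  move=> p; rewrite inE => -[[hp gp] hp0]; rewrite /= tree_phiC// => h1.
  by apply: hp0; split.
have e : mu (cube k m `\` cube k0 m0) = (vol k - vol k0)%:E.
  have fC : (mu (cube k m) < +oo)%E by rewrite measure_cube ltry.
  rewrite measureD// setIidr// EFinB; congr (_ - _)%E; exact: measure_cube.
rewrite integral_cst; last exact: measurableD.
rewrite [X in (_ + _ * X)%E](_ : _ = (vol k - vol k0)%:E); last exact: e.
rewrite -EFinM -EFinD; congr EFin.
by have v0 := vol_gt0 R n k; field; rewrite gt_eqF.
Qed.

(** The average over a larger cube falls short of [L] by [L - (pt t).1] times the ratio of the
    volumes. This deficit is nonnegative and tends to 0 along the ancestors of the root cube. *)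
Lemma tree_phi_sup : ereal_sup [set avg J (EFin \o tree_phi)
  | J in dyadic `&` [set J | dcube k0 m0 `<=` J]] = L%:E.
Proof using n_ge1 tL.
have d0 : 0 <= L - (pt t).1 by rewrite subr_ge0.
apply/eqP; rewrite eq_le; apply/andP; split.
  apply: ge_ereal_sup => _ [J [[k [m ->]] h] <-].
  by rewrite tree_phi_avg_above// lee_fin gerBl mulr_ge0// divr_ge0// ltW ?vol_gt0.
apply/lee_addgt0Pr => e e0.
pose d := Num.Def.archi_bound ((L - (pt t).1) / e).
have [m h] := parent_cube d k0 m0.
have le : (L - (pt t).1) * (vol k0 / vol (k0 + d%:Z)) <= e.
  have -> : vol k0 / vol (k0 + d%:Z) = (2 ^- (d * n)).
    rewrite /vol expfzDr// exprMn invfM mulrA divff ?mul1r -?exprM//.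
    by rewrite expf_neq0// gt_eqF// two_gt0.
  rewrite ler_pdivrMr ?exprn_gt0// mulrC -ler_pdivrMr//.
  apply: le_trans (ltW (unstable.ltr_bound _)) _; rewrite -natrX ler_nat.
  apply: leq_trans (ltnW (ltn_expl _ _)) _; first exact: (isT : (1 < 2)%N).
  by rewrite leq_exp2l// leq_pmulr.
apply: (@le_trans _ _ (avg (dcube (k0 + d%:Z) m) (EFin \o tree_phi) + e%:E)%E).
  by rewrite tree_phi_avg_above// -EFinD lee_fin; lra.
rewrite leeD2r//; apply: ereal_sup_ubound; exists (dcube (k0 + d%:Z) m) => //.
by split => //; exists (k0 + d%:Z), m.
Qed.

Lemma tree_phi_class : bellman_class (pt t) L (dcube k0 m0) tree_phi.
Proof using n_ge1 vt ft tL.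
have bmo := tree_phi_bmo; split => //.
- exact: tree_phi_loc.
- by apply: le_lt_trans bmo _; exact: ltry.
- exact: tree_phi_avg.
- exact: tree_phi_avg2.
- exact: tree_phi_sup.
Qed.

Lemma tree_phi_maximal : (((tree_val L t - L) * vol k0)%:E <=
  \int[mu]_(p in cube k0 m0) (dyadic_maximal tree_phi p - L%:E))%E.
Proof using n_ge1 vt ft tL.
rewrite -(integral_smaxB t L L k0 m0); apply: ge0_le_integral.
- exact: measurable_cube.
- by move=> p _; rewrite lee_fin subr_ge0 smax_ge.
- apply/measurable_EFinP; apply: measurable_funB; last exact: measurable_cst.
  exact: measurable_funTS (measurable_smax _ _ _ _).
- apply: emeasurable_funB; last exact: measurable_cst.
  exact: measurable_funTS (measurable_maximal _).
- move=> p hp; rewrite EFinB leeB//; apply: smax_le_maximal => //.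
    by move=> q; exact: tree_phiE.
  by apply: (class_maximal_ge tree_phi_class); case: hp.
Qed.
End phi.
End class_lower.

Theorem theorem2p13 (R : realType) (n : nat) (n_ge1 : (1 <= n)%N)
    (Q : set (Rn R n)) (Q_dyadic : dyadic Q)
    (x : R * R) (L : R) (xL_S : S_domain (x, L)) :
  bellman Q x L = (bellman_candidate n x L)%:E.
Proof.
have [k0 [m0 ->]] := Q_dyadic; have [/andP[/= x1 x2] xL] := xL_S.
have x01 : 0 <= vari x <= 1 by rewrite subr_ge0 x1 lerBlDl.
have z01 : 0 <= vari (Tshift L x) <= 1 by rewrite vari_Tshift.
have bB : bval (rt R n) (Tshift L x) (B (2 ^- n) (Tshift L x)).
  (* By [graph_total] the choice in B returns a value of the graph, never the default 0. *)
  apply: (graph_bval (rt_gt0 R n) (rt_small R n_ge1)) => //.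
  rewrite -rt2; apply: xgetPex.
  exact: (graph_total (rt_gt0 R n) (rt_small R n_ge1)).
rewrite /bellman_candidate; set b := B _ _ in bB *.
apply/eqP; rewrite eq_le; apply/andP; split.
  apply: ge_ereal_sup => _ [phi phiE <-].
  have [r /andP[_ rb] rE] := class_upper n_ge1 phiE bB.
  have NL p : cube k0 m0 p -> (L%:E <= dyadic_maximal phi p)%E.
    by move=> [+ _]; exact: class_maximal_ge phiE p.
  by rewrite (avg_maximal NL rE) lee_fin lerD2l.
apply/lee_addgt0Pr => e e0.
have [t [vt ft tx te]] := tree_val_ex n_ge1 x01 bB e0.
have tL : (pt t).1 <= L by rewrite tx.
have phiE := tree_phi_class n_ge1 k0 m0 vt ft tL; rewrite tx in phiE.
(* The upper bound is applied to the extremal function as well: it makes the integral finite, so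
   that the average of its maximal function can be computed. *)
have [r /andP[_ rb] rE] := class_upper n_ge1 phiE bB.
have NL p : cube k0 m0 p -> (L%:E <= dyadic_maximal (tree_phi k0 m0 t L) p)%E.
  by move=> [+ _]; exact: class_maximal_ge phiE p.
have := tree_phi_maximal n_ge1 k0 m0 vt ft tL.
rewrite rE lee_fin ler_pM2r ?vol_gt0// => tr.
apply: (@le_trans _ _ (avg (dyadic_cube k0 m0)
    (dyadic_maximal (tree_phi k0 m0 t L)) + e%:E)%E).
  by rewrite (avg_maximal NL rE) -EFinD lee_fin; lra.
by rewrite leeD2r//; apply: ereal_sup_ubound; exists (tree_phi k0 m0 t L).
Qed.
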